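(* Work over $\mathbb{C}$. For parameters $a,b,c,d,e,k,l,m,n,p,q$ let $T_2=ax^2+bxy+cy^2+dx+ey+1$ and $$P=-\bigl(-y(ky+lx)-(py+qx)T_2-(2ax+by+d)(-qx^2+(n-p)xy+my^2)\bigr),$$ $$Q=-x(ky+lx)-(my+nx)T_2+(bx+2cy+e)(-qx^2+(n-p)xy+my^2).$$ For general values of the parameters (i.e. for all values in a nonempty Zariski open set) the differential form $Pdx+Qdy$, a general differential form of \.{Z}o\l adek's family $CR_{16}$, has the conic integral curve $$\bigl\{(mq-np)T_2+(kq-lp)x-(kn-lm)y=0\bigr\}$$ and is Darboux integrable. Moreover $X_{CR16}\subset\overline{X_{(2,1,1)}}$.
   Context: Differential forms. $V^3=\mathbb{C}[x,y,z]_3\oplus\mathbb{C}[x,y,z]_3$ is the vector space of pairs $(P,Q)$ of homogeneous cubic polynomials, written $Pdx+Qdy$; inhomogeneous $P,Q\in\mathbb{C}[x,y]$ of degree $\le3$ are regarded as elements of $V^3$ by homogenizing with $z$. A form is a Poincar\'e differential form if at $(x,y,z)=(0,0,1)$ one has $P=Q=0$, $P_x=Q_y=1$, $P_y=Q_x=0$; the set of these is the $14$-dimensional affine space $V^3_{\text{Poincar\'e}}$. Integral curves and Darboux integrability. For homogeneous $F$, the curve $\{F=0\}\subset\mathbb{P}^2$ is an integral curve of $Pdx+Qdy$ if there is a homogeneous polynomial $K_F$ of degree $2$ (the cofactor) with $PF_y-QF_x=-FK_F$ (after homogenizing). $Pdx+Qdy$ is Darboux integrable if it has integral curves with cofactors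 $K_1,\dots,K_n$ and there are scalars $\alpha_i$ with $Q_x-P_y=\sum_i\alpha_iK_i$. The set $X_{(2,1,1)}$. It is the set of Poincar\'e forms in $V^3$ having as integral curves a smooth conic and two lines such that: none of the three curves is tangent to the line at infinity $\{z=0\}$; no two are tangent to each other; no two meet the line at infinity at the same point; the three do not meet in a common point. The bar denotes Zariski closure. The family. $Y_{CR16}\subset V^3$ is the family of all forms obtained from the displayed forms $Pdx+Qdy$ (all parameter values) by affine changes of the coordinates $(x,y)$, and $X_{CR16}=Y_{CR16}\cap V^3_{\text{Poincar\'e}}$. *)

(* Defs.v *)
From HB Require Import structures.
From mathcomp Require Import all_boot all_order all_algebra.
From mathcomp Require Import reals complex.
From mathcomp Require Import mpoly.

Set Implicit Arguments.
Unset Strict Implicit.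
Unset Printing Implicit Defensive.

Import Order.TTheory GRing.Theory Num.Theory.
Local Open Scope ring_scope.

(* The variables x, y, z are 'X_0, 'X_1, 'X_2; inhomogeneous polynomials live
   in {mpoly C[2]}, homogeneous ones in {mpoly C[3]}.  Points of P^2 are
   represented by nonzero row vectors. *)

(* z^d p(x/z, y/z); monomials of p of degree > d, if any, are dropped. *)
Definition homogenize (C : fieldType) (d : nat) (p : {mpoly C[2]}) :
    {mpoly C[3]} :=
  \sum_(m <- msupp p | (mdeg m <= d)%N)
     p@_m *: ('X_0 ^+ m 0 * 'X_1 ^+ m 1 * 'X_2 ^+ (d - mdeg m)).

Lemma homogenize_homog (C : fieldType) (d : nat) (p : {mpoly C[2]}) :
  homogenize d p \is d.-homog.
Proof.
rewrite /homogenize; apply: rpred_sum => m le_md; apply: rpredZ.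
rewrite !mpolyXn -!mpolyXD dhomogX /=.
rewrite !mdegD !mdegMn !mdeg1 !mul1n.
have -> : (m 0%R + m 1%R)%N = mdeg m.
  rewrite mdegE !big_ord_recl big_ord0 addn0.
  by congr (m _ + m _)%N; apply: val_inj.
by rewrite subnKC.
Qed.

(* V^3; the pair (P, Q) stands for P dx + Q dy. *)
Definition V3 (C : fieldType) : vectType C := (dhomog 3 C 3 * dhomog 3 C 3)%type.

Definition coefP (C : fieldType) (w : V3 C) : {mpoly C[3]} := w.1.
Definition coefQ (C : fieldType) (w : V3 C) : {mpoly C[3]} := w.2.

Definition affine_form (C : fieldType) (P Q : {mpoly C[2]}) : V3 C :=
  (DHomog (homogenize_homog 3 P), DHomog (homogenize_homog 3 Q)).

Definition poincare (C : fieldType) (w : V3 C) : Prop :=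
  let o : 'rV[C]_3 := delta_mx 0 2 in
  [/\ (coefP w).@[o 0] = 0 /\ (coefQ w).@[o 0] = 0,
      (coefP w)^`M(0).@[o 0] = 1 /\ (coefQ w)^`M(1).@[o 0] = 1
    & (coefP w)^`M(1).@[o 0] = 0 /\ (coefQ w)^`M(0).@[o 0] = 0].

Definition cofactor (C : fieldType) (w : V3 C) (F K : {mpoly C[3]}) : Prop :=
  K \is 2.-homog /\
  coefP w * F^`M(1) - coefQ w * F^`M(0) = - (F * K).

Definition is_curve (C : fieldType) (d : nat) (F : {mpoly C[3]}) : Prop :=
  [/\ (0 < d)%N, F != 0 & F \is d.-homog].

Definition integral_curve (C : fieldType) (w : V3 C) (d : nat)
    (F : {mpoly C[3]}) : Prop :=
  is_curve d F /\ exists K, cofactor w F K.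

Definition darboux_integrable (C : fieldType) (w : V3 C) : Prop :=
  exists (n : nat) (F K : 'I_n -> {mpoly C[3]}) (alpha : 'I_n -> C),
    (forall i, (exists d, is_curve d (F i)) /\ cofactor w (F i) (K i)) /\
    (coefQ w)^`M(0) - (coefP w)^`M(1) = \sum_(i < n) alpha i *: K i.

Definition gradient (C : fieldType) (F : {mpoly C[3]}) (p : 'rV[C]_3) :
    'rV[C]_3 :=
  \row_i (F^`M(i)).@[p 0].

Definition smooth_curve (C : fieldType) (F : {mpoly C[3]}) : Prop :=
  forall p : 'rV[C]_3, p != 0 -> F.@[p 0] = 0 -> gradient F p != 0.

(* Two smooth curves share a tangent line at p iff their gradients there are
   proportional.  For two lines this means that they coincide. *)
Definition tangent (C : fieldType) (F G : {mpoly C[3]}) : Prop :=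
  exists p : 'rV[C]_3,
    [/\ p != 0, F.@[p 0] = 0, G.@[p 0] = 0
      & (\rank (col_mx (gradient F p) (gradient G p)) < 2)%N].

Definition meet_at_infinity (C : fieldType) (F G : {mpoly C[3]}) : Prop :=
  exists p : 'rV[C]_3, [/\ p != 0, p 0 2 = 0, F.@[p 0] = 0 & G.@[p 0] = 0].

Definition concurrent (C : fieldType) (F G H : {mpoly C[3]}) : Prop :=
  exists p : 'rV[C]_3,
    [/\ p != 0, F.@[p 0] = 0, G.@[p 0] = 0 & H.@[p 0] = 0].

Definition X_211 (C : fieldType) (w : V3 C) : Prop :=
  poincare w /\
  exists F L1 L2 : {mpoly C[3]},
    [/\ integral_curve w 2 F, smooth_curve F,
        integral_curve w 1 L1 & integral_curve w 1 L2] /\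
    [/\ [/\ ~ tangent F 'X_2, ~ tangent L1 'X_2 & ~ tangent L2 'X_2],
        [/\ ~ tangent F L1, ~ tangent F L2 & ~ tangent L1 L2],
        [/\ ~ meet_at_infinity F L1, ~ meet_at_infinity F L2
          & ~ meet_at_infinity L1 L2]
      & ~ concurrent F L1 L2].

Definition zariski_closed (C : fieldType) (n : nat) (Z : 'rV[C]_n -> Prop) :
    Prop :=
  exists I : {mpoly C[n]} -> Prop,
    forall v, Z v <-> (forall f, I f -> f.@[v 0] = 0).

Definition zariski_open (C : fieldType) (n : nat) (U : 'rV[C]_n -> Prop) :
    Prop :=
  zariski_closed (fun v => ~ U v).

Definition coordinates (C : fieldType) (V : vectType C) (w : V) :
    'rV[C]_(\dim {:V}) :=
  \row_i coord (vbasis {:V}) i w.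

(* V is identified with affine space by a choice of linear coordinates, on
   which the closure does not depend. *)
Definition zariski_closure (C : fieldType) (V : vectType C) (S : V -> Prop)
    (w : V) : Prop :=
  forall Z : 'rV[C]_(\dim {:V}) -> Prop, zariski_closed Z ->
    (forall u, S u -> Z (coordinates u)) -> Z (coordinates w).

Definition T2 (C : fieldType) (a b c d e : C) : {mpoly C[2]} :=
  let x := 'X_0 in let y := 'X_1 in
  a *: x ^+ 2 + b *: (x * y) + c *: y ^+ 2 + d *: x + e *: y + 1.

Definition cr16P (C : fieldType) (a b c d e k l m n p q : C) : {mpoly C[2]} :=
  let x := 'X_0 in let y := 'X_1 in
  - (- (y * (k *: y + l *: x))
     - (p *: y + q *: x) * T2 a b c d e
     - ((2 * a) *: x + b *: y + d%:MP)
       * (- q *: x ^+ 2 + (n - p) *: (x * y) + m *: y ^+ 2)).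

Definition cr16Q (C : fieldType) (a b c d e k l m n p q : C) : {mpoly C[2]} :=
  let x := 'X_0 in let y := 'X_1 in
  - (x * (k *: y + l *: x))
  - (m *: y + n *: x) * T2 a b c d e
  + (b *: x + (2 * c) *: y + e%:MP)
    * (- q *: x ^+ 2 + (n - p) *: (x * y) + m *: y ^+ 2).

Definition cr16_conic (C : fieldType) (a b c d e k l m n p q : C) :
    {mpoly C[2]} :=
  let x := 'X_0 in let y := 'X_1 in
  (m * q - n * p) *: T2 a b c d e + (k * q - l * p) *: x
  - (k * n - l * m) *: y.

(* The affine map phi with components phi_i = \sum_j A i j X_j + t_i. *)
Definition affine_map (C : fieldType) (A : 'M[C]_2) (t : 'rV[C]_2) :
    2.-tuple {mpoly C[2]} :=
  [tuple \sum_(j < 2) A i j *: 'X_j + (t 0 i)%:MP | i < 2].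

(* The coefficient of d X_j in the pullback phi^*(P dx + Q dy). *)
Definition pullback (C : fieldType) (A : 'M[C]_2) (t : 'rV[C]_2)
    (P Q : {mpoly C[2]}) (j : 'I_2) : {mpoly C[2]} :=
  A 0 j *: (P \mPo affine_map A t) + A 1 j *: (Q \mPo affine_map A t).

Definition Y_CR16 (C : fieldType) (w : V3 C) : Prop :=
  exists (a b c d e k l m n p q : C) (A : 'M[C]_2) (t : 'rV[C]_2),
    A \in unitmx /\
    let P := cr16P a b c d e k l m n p q in
    let Q := cr16Q a b c d e k l m n p q in
    w = affine_form (pullback A t P Q 0) (pullback A t P Q 1).

Definition X_CR16 (C : fieldType) (w : V3 C) : Prop :=
  Y_CR16 w /\ poincare w.

(* Main.v *)
Require Import Defs.
From HB Require Import structures.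
From mathcomp Require Import all_boot all_order all_algebra.
From mathcomp Require Import reals complex.
From mathcomp Require Import mpoly ssrcomplements ring.

Set Implicit Arguments.
Unset Strict Implicit.
Unset Printing Implicit Defensive.

Import Order.TTheory GRing.Theory Num.Theory.
Local Open Scope ring_scope.

(** A form of the family is built from affine coordinates [X], [Y] vanishing at
    a point [c], linear forms [U = qX + pY], [V = nX + mY], [W = lX + kY] and a
    quadric [T]: with [M = YV - XU] it is
      [omega = W (Y dX - X dY) + T (U dX - V dY) + M dT].

    When [D = mq - np] is nonzero, [W] is a combination of [U] and [V] and can
    be absorbed in [T]: for the conic [F = D T + (kq - lp) X - (kn - lm) Y],
      [D omega = F (U dX - V dY) + M dF]   (lemmas [crA_factor], [crB_factor]).
    So [F = 0] is an integral curve.  The pair of lines [M = 0] through [c] is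
    another one, because [- M] is the contraction of [U dX - V dY] with the
    Euler field at [c].  Moreover [omega / (F M)] is closed, which means that
    the cofactors of [F] and [M] add up to the curl of [omega].  This is Darboux
    integrability, with both coefficients equal to [1].

    If [M] splits as a product [L1 L2] of distinct lines, then [omega] is a
    combination of [L1 L2 dF], [F L2 dL1] and [F L1 dL2]; when the conic and the
    lines are in general position a Poincare form of this shape is in
    [X_(2,1,1)] ([cr_form_X211]).  General position is the non-vanishing of one
    polynomial expression in the coefficients ([general_position]).

    For the closure, let [omega] be a Poincare form of the family.  The Poincare
    conditions are six scalar equations ([poincare_cr_form]).  They imply that
    twice the value of [M] at the origin is the value of [x ^ 2 + y ^ 2] at [c],
    so that their nature depends on the position of [c] with respect to this
    quadratic form: [c] may be the origin, another isotropic point, or an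
    anisotropic point.  In each case, in linear coordinates chosen such that
    [c] becomes a fixed point, the equations express some of the parameters as
    polynomials in the others, which are free.  Hence [omega] can be joined,
    with [c] fixed, to an explicit example in general position by a
    polynomial curve of Poincare forms [w_s], with [w_0 = omega].  All but
    finitely many [w_s] are then in [X_(2,1,1)], and a polynomial that vanishes
    on [X_(2,1,1)] vanishes at [w_0] as well
    ([closure_of_polynomial_curve]). *)

(** * Homogenization *)

Definition dehomogenize (C : fieldType) (G : {mpoly C[3]}) : {mpoly C[2]} :=
  G \mPo [tuple 'X_0; 'X_1; 1].

Lemma homogenizeE (C : fieldType) (d k : nat) (p : {mpoly C[2]}) :
  (msize p <= k)%N ->
  homogenize d p = \sum_(m : 'X_{1..2 < k} | (mdeg m <= d)%N)
     p@_m *: ('X_0 ^+ m 0 * 'X_1 ^+ m 1 * 'X_2 ^+ (d - mdeg m)).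
Proof.
move=> le_pk; rewrite /homogenize.
rewrite (big_mksub_cond 'X_{1..2 < k}) ?msupp_uniq //=; last first.
  by move=> m /msize_mdeg_lt /leq_trans /(_ le_pk) ->.
rewrite -big_filter_cond big_rmcond ?big_filter //=.
by move=> m /memN_msupp_eq0 ->; rewrite scale0r.
Qed.

Lemma homogenizeD (C : fieldType) d :
  {morph @homogenize C d : p q / p + q}.
Proof.
move=> p q.
pose k := maxn (msize (p + q)) (maxn (msize p) (msize q)).
rewrite !(@homogenizeE _ _ k) ?leq_max ?leqnn ?orbT //.
rewrite -big_split /=; apply: eq_bigr => m _.
by rewrite mcoeffD scalerDl.
Qed.

Lemma homogenizeZ (C : fieldType) d a (p : {mpoly C[2]}) :
  homogenize d (a *: p) = a *: homogenize d p.
Proof.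
rewrite !(@homogenizeE _ _ (msize p)) ?msizeZ_le //.
by rewrite scaler_sumr; apply: eq_bigr => m _; rewrite mcoeffZ scalerA.
Qed.

Lemma mdeg3E (m : 'X_{1..3}) : mdeg m = (m 0%R + m 1%R + m 2%R)%N.
Proof.
rewrite mdegE !big_ord_recl big_ord0 addn0 addnA.
by congr (m _ + m _ + m _)%N; apply: val_inj.
Qed.

(** Every homogenization below is computed through this left inverse: it is
    enough to exhibit a homogeneous polynomial with the right restriction to
    [z = 1]. *)
Lemma dehomogenizeK (C : fieldType) (d : nat) (G : {mpoly C[3]}) :
  G \is d.-homog -> homogenize d (dehomogenize G) = G.
Proof.
have hX (m : 'X_{1..3}) : mdeg m = d ->
    homogenize d (dehomogenize 'X_[C, m]) = 'X_[m].
  move=> dm; rewrite /dehomogenize comp_mpolyX.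
  rewrite !big_ord_recl big_ord0 !(tnth_nth 0) /= expr1n !mulr1.
  rewrite !mpolyXn -!mpolyXD.
  set m' := (_ + _)%MM.
  rewrite /homogenize msuppX big_cons big_nil addr0.
  have e0 : m' 0 = m 0 by rewrite mnmDE !mulmnE !mnm1E /= mul1n mul0n addn0.
  have e1 : m' 1 = m 1.
    rewrite mnmDE !mulmnE !mnm1E /= mul1n mul0n add0n.
    by congr (m _); apply: val_inj.
  have e : mdeg m' = (m 0%R + m 1%R)%N.
    rewrite mdegE !big_ord_recl big_ord0 addn0 -e0 -e1.
    by congr (m' _ + m' _)%N; apply: val_inj.
  have := mdeg3E m; rewrite dm => dE.
  rewrite e dE leq_addr addKn mcoeffX eqxx scale1r e0 e1.
  rewrite [in RHS]mpolyXE_id !big_ord_recl big_ord0 mulr1 mulrA.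
  by congr ('X_ _ ^+ m _ * 'X_ _ ^+ m _ * 'X_ _ ^+ m _); apply: val_inj.
have h0 : homogenize d (0 : {mpoly C[2]}) = 0.
  by rewrite /homogenize msupp0 big_nil.
move=> /dhomogP hG; rewrite /dehomogenize [in RHS](mpolyE G) comp_mpolyEX.
rewrite (big_morph _ (@homogenizeD C d) h0) big_seq [RHS]big_seq.
by apply: eq_bigr => m /hG dm; rewrite homogenizeZ hX.
Qed.

(** * The family in centred coordinates *)

(** The eleven parameters of the family, together with the constant term [pt]
    of the quadric, which is [1] in the family itself.  Letting it vary makes
    room for the rescaling of [cr_rescale]. *)
Record params (K : Type) := Params
  { pa : K; pb : K; pc : K; pd : K; pe : K; pt : K; pk : K; pl : K;
    pm : K; pn : K; pp : K; pq : K }.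

Definition map_params (K L : Type) (f : K -> L) (th : params K) : params L :=
  Params (f (pa th)) (f (pb th)) (f (pc th)) (f (pd th)) (f (pe th)) (f (pt th))
    (f (pk th)) (f (pl th)) (f (pm th)) (f (pn th)) (f (pp th)) (f (pq th)).

Section Cr16.
Variable K : comNzRingType.
Implicit Types (X Y Z : K) (th : params K).

Definition crT th X Y Z : K :=
  pa th * X ^+ 2 + pb th * X * Y + pc th * Y ^+ 2 + pd th * X * Z
  + pe th * Y * Z + pt th * Z ^+ 2.
Definition crTX th X Y Z : K := 2 * pa th * X + pb th * Y + pd th * Z.
Definition crTY th X Y Z : K := pb th * X + 2 * pc th * Y + pe th * Z.
Definition crU th X Y : K := pq th * X + pp th * Y.
Definition crV th X Y : K := pn th * X + pm th * Y.
Definition crW th X Y : K := pl th * X + pk th * Y.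
Definition crM th X Y : K := Y * crV th X Y - X * crU th X Y.
(** [crA] and [crB] are the coefficients of [dX] and [dY] in
    [W (Y dX - X dY) + T (U dX - V dY) + M dT], homogenized by [Z]; [crTX],
    [crFX] and the like are partial derivatives. *)
Definition crA th X Y Z : K :=
  crW th X Y * Y * Z + crU th X Y * crT th X Y Z + crM th X Y * crTX th X Y Z.
Definition crB th X Y Z : K :=
  - (crW th X Y * X * Z) - crV th X Y * crT th X Y Z
  + crM th X Y * crTY th X Y Z.
Definition crD th : K := pm th * pq th - pn th * pp th.
Definition crF th X Y Z : K :=
  crD th * crT th X Y Z + (pk th * pq th - pl th * pp th) * X * Z
  - (pk th * pn th - pl th * pm th) * Y * Z.
Definition crFX th X Y Z : K :=
  crD th * crTX th X Y Z + (pk th * pq th - pl th * pp th) * Z.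
Definition crFY th X Y Z : K :=
  crD th * crTY th X Y Z - (pk th * pn th - pl th * pm th) * Z.

(** By Cramer's rule [D W] is a combination of [U] and [V]; the corresponding
    linear terms turn [D T] into [F]. *)
Lemma crA_factor th X Y Z :
  crD th * crA th X Y Z =
  crF th X Y Z * crU th X Y + crM th X Y * crFX th X Y Z.
Proof.
rewrite /crA /crF /crFX /crM /crU /crV /crW /crT /crTX /crD; ring.
Qed.

Lemma crB_factor th X Y Z :
  crD th * crB th X Y Z =
  - (crF th X Y Z * crV th X Y) + crM th X Y * crFY th X Y Z.
Proof.
rewrite /crB /crF /crFY /crM /crU /crV /crW /crT /crTY /crD; ring.
Qed.

(** The substitution [X := a11 X + a12 Y], [Y := a21 X + a22 Y] composes [T]
    with the matrix, turns the bilinear form that encodes [U dX - V dY] into a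
    congruent one, and multiplies [Y dX - X dY] by the determinant. *)
Definition params_linear_change th (a11 a12 a21 a22 : K) : params K :=
  let det := a11 * a22 - a12 * a21 in
  let: Params a b c d e t k l m n p q := th in
  {| pa := a * a11 ^+ 2 + b * a11 * a21 + c * a21 ^+ 2;
     pb := 2 * a * a11 * a12 + b * (a11 * a22 + a12 * a21) + 2 * c * a21 * a22;
     pc := a * a12 ^+ 2 + b * a12 * a22 + c * a22 ^+ 2;
     pd := d * a11 + e * a21;
     pe := d * a12 + e * a22;
     pt := t;
     pk := det * (l * a12 + k * a22);
     pl := det * (l * a11 + k * a21);
     pm := a22 * (n * a12 + m * a22) - a12 * (q * a12 + p * a22);
     pn := a22 * (n * a11 + m * a21) - a12 * (q * a11 + p * a21);
     pp := a11 * (q * a12 + p * a22) - a21 * (n * a12 + m * a22);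
     pq := a11 * (q * a11 + p * a21) - a21 * (n * a11 + m * a21) |}.

Lemma cr_linear_change th X Y Z a11 a12 a21 a22 :
  let X' := a11 * X + a12 * Y in let Y' := a21 * X + a22 * Y in
  let th' := params_linear_change th a11 a12 a21 a22 in
  a11 * crA th X' Y' Z + a21 * crB th X' Y' Z = crA th' X Y Z /\
  a12 * crA th X' Y' Z + a22 * crB th X' Y' Z = crB th' X Y Z.
Proof.
case: th => a b c d e t k l m n p q /=.
by rewrite /crA /crB /crM /crU /crV /crW /crT /crTX /crTY /=; split; ring.
Qed.

End Cr16.

Section Cr16Morphism.
Variables (K L : comNzRingType) (f : {rmorphism K -> L}).

Lemma rmorph_crA th X Y Z :
  f (crA th X Y Z) = crA (map_params f th) (f X) (f Y) (f Z).
Proof. by rewrite /crA /crM /crU /crV /crW /crT /crTX /=; ring. Qed.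

Lemma rmorph_crB th X Y Z :
  f (crB th X Y Z) = crB (map_params f th) (f X) (f Y) (f Z).
Proof. by rewrite /crB /crM /crU /crV /crW /crT /crTY /=; ring. Qed.

Lemma rmorph_crF th X Y Z :
  f (crF th X Y Z) = crF (map_params f th) (f X) (f Y) (f Z).
Proof. by rewrite /crF /crT /crD /=; ring. Qed.
End Cr16Morphism.

Lemma dhomogCM (C : fieldType) (n d : nat) (c : C) (p : {mpoly C[n]}) :
  p \is d.-homog -> c%:MP * p \is d.-homog.
Proof. by move=> hp; rewrite mul_mpolyC; apply: rpredZ. Qed.

Lemma dhomogMC (C : fieldType) (n d : nat) (c : C) (p : {mpoly C[n]}) :
  p \is d.-homog -> p * c%:MP \is d.-homog.
Proof. by rewrite mulrC; apply: dhomogCM. Qed.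

Lemma dhomogX1 (C : fieldType) (n : nat) (i : 'I_n) :
  ('X_i : {mpoly C[n]}) \is 1.-homog.
Proof. by rewrite dhomogX /= mdeg1. Qed.

(** In degree at most 3 the factors of a nonconstant product have degrees
    1 and 1, 1 and 2, or 2 and 1. *)
Ltac solve_homog :=
  lazymatch goal with
  | |- is_true (in_mem ?p _) =>
    lazymatch p with
    | _ + _ => apply: rpredD; solve_homog
    | - _ => rewrite rpredN; solve_homog
    | _ *: _ => apply: rpredZ; solve_homog
    | 'X_ _ => exact: dhomogX1
    | _%:MP * _ => apply: dhomogCM; solve_homog
    | _ * _%:MP => apply: dhomogMC; solve_homog
    | _ * _ =>
        first [ solve [apply: (@dhomogM _ _ _ 1 _ 1); solve_homog]
              | solve [apply: (@dhomogM _ _ _ 1 _ 2); solve_homog]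
              | solve [apply: (@dhomogM _ _ _ 2 _ 1); solve_homog] ]
    | _ ^+ 2 => apply: (@dhomogMn _ _ _ 1 _ 2); solve_homog
    | _ => assumption
    end
  end.

Section Homogenized.
Variable C : fieldType.
Implicit Types (th : params C) (X Y Z : {mpoly C[3]}).

Definition cstp n th : params {mpoly C[n]} := map_params (@mpolyC n C) th.

Lemma crA_homog th X Y Z : X \is 1.-homog -> Y \is 1.-homog ->
  Z \is 1.-homog -> crA (cstp 3 th) X Y Z \is 3.-homog.
Proof.
move=> hX hY hZ; rewrite /crA /crM /crU /crV /crW /crT /crTX /=.
rewrite -mpolyC_nat -mpolyCM.
solve_homog.
Qed.

Lemma crB_homog th X Y Z : X \is 1.-homog -> Y \is 1.-homog ->
  Z \is 1.-homog -> crB (cstp 3 th) X Y Z \is 3.-homog.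
Proof.
move=> hX hY hZ; rewrite /crB /crM /crU /crV /crW /crT /crTY /=.
rewrite -mpolyC_nat -mpolyCM.
solve_homog.
Qed.

Lemma crF_homog th X Y Z : X \is 1.-homog -> Y \is 1.-homog ->
  Z \is 1.-homog -> crF (cstp 3 th) X Y Z \is 2.-homog.
Proof.
move=> hX hY hZ; rewrite /crF /crD /crT /= -!mpolyCM -!mpolyCB.
solve_homog.
Qed.

Lemma cr16PE a b c d e k l m n p q :
  cr16P a b c d e k l m n p q =
  crA (cstp 2 (Params a b c d e 1 k l m n p q)) 'X_0 'X_1 1.
Proof.
rewrite /cr16P /T2 /crA /crM /crU /crV /crW /crT /crTX /= -!mul_mpolyC; ring.
Qed.

Lemma cr16QE a b c d e k l m n p q :
  cr16Q a b c d e k l m n p q =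
  crB (cstp 2 (Params a b c d e 1 k l m n p q)) 'X_0 'X_1 1.
Proof.
rewrite /cr16Q /T2 /crB /crM /crU /crV /crW /crT /crTY /= -!mul_mpolyC; ring.
Qed.

Lemma cr16_conicE a b c d e k l m n p q :
  cr16_conic a b c d e k l m n p q =
  crF (cstp 2 (Params a b c d e 1 k l m n p q)) 'X_0 'X_1 1.
Proof. rewrite /cr16_conic /T2 /crF /crD /crT /= -!mul_mpolyC; ring. Qed.

Definition affine_lin (u v t : C) : {mpoly C[3]} :=
  u%:MP * 'X_0 + v%:MP * 'X_1 + t%:MP * 'X_2.

Lemma affine_lin_homog u v t : affine_lin u v t \is 1.-homog.
Proof. rewrite /affine_lin; solve_homog. Qed.

End Homogenized.

Section Dehomogenize.
Variable C : fieldType.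
Implicit Types (th : params C) (X Y Z : {mpoly C[3]}).

Lemma dehomogenize_X i :
  dehomogenize ('X_i : {mpoly C[3]}) = [tuple 'X_0; 'X_1; 1]`_i.
Proof. exact: comp_mpolyXU. Qed.

Lemma map_cstp (L : comNzRingType) (f : {mpoly C[3]} -> L) g th :
  (forall c, f c%:MP = g c) -> map_params f (cstp 3 th) = map_params g th.
Proof. by move=> fE; rewrite /map_params /= !fE. Qed.

Lemma dehomogenize_cr th X Y :
  [/\ dehomogenize (crA (cstp 3 th) X Y 'X_2) =
      crA (cstp 2 th) (dehomogenize X) (dehomogenize Y) 1,
      dehomogenize (crB (cstp 3 th) X Y 'X_2) =
      crB (cstp 2 th) (dehomogenize X) (dehomogenize Y) 1 &
      dehomogenize (crF (cstp 3 th) X Y 'X_2) =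
      crF (cstp 2 th) (dehomogenize X) (dehomogenize Y) 1].
Proof.
have thE : map_params (@dehomogenize C) (cstp 3 th) = cstp 2 th.
  by apply: map_cstp => c; apply: comp_mpolyC.
have X2 : dehomogenize ('X_2 : {mpoly C[3]}) = 1 by apply: dehomogenize_X.
rewrite -thE -X2.
by split; [apply: rmorph_crA | apply: rmorph_crB | apply: rmorph_crF].
Qed.

Lemma dehomogenize_affine_lin (A : 'M[C]_2) (t : 'rV[C]_2) i :
  dehomogenize (affine_lin (A i 0) (A i 1) (t 0 i)) =
  (affine_map A t)`_i.
Proof.
rewrite -tnth_nth tnth_mktuple !big_ord_recl big_ord0 addr0.
rewrite /dehomogenize /affine_lin !rmorphD !rmorphM /= !comp_mpolyC.
rewrite -!/(dehomogenize _) !dehomogenize_X /= mulr1 -!mul_mpolyC.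
by congr (_ * 'X_ _ + (A i _)%:MP * 'X_ _ + _); apply: val_inj.
Qed.

Lemma homogenize_cr16 (a b c d e k l m n p q : C) :
  let th := cstp 3 (Params a b c d e 1 k l m n p q) in
  [/\ homogenize 3 (cr16P a b c d e k l m n p q) = crA th 'X_0 'X_1 'X_2,
      homogenize 3 (cr16Q a b c d e k l m n p q) = crB th 'X_0 'X_1 'X_2 &
      homogenize 2 (cr16_conic a b c d e k l m n p q) = crF th 'X_0 'X_1 'X_2].
Proof.
move=> th; rewrite cr16PE cr16QE cr16_conicE.
have [hA hB hF] := dehomogenize_cr (Params a b c d e 1 k l m n p q) 'X_0 'X_1.
rewrite !dehomogenize_X /= in hA hB hF; rewrite -hA -hB -hF.
by split; apply: dehomogenizeK;
  rewrite ?crA_homog ?crB_homog ?crF_homog ?dhomogX1.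
Qed.

Lemma homogenize_pullback (A : 'M[C]_2) (t : 'rV[C]_2) j (a b c d e k l m n p q : C) :
  let th := cstp 3 (Params a b c d e 1 k l m n p q) in
  let X := affine_lin (A 0 0) (A 0 1) (t 0 0) in
  let Y := affine_lin (A 1 0) (A 1 1) (t 0 1) in
  homogenize 3 (pullback A t (cr16P a b c d e k l m n p q)
                             (cr16Q a b c d e k l m n p q) j) =
  (A 0 j)%:MP * crA th X Y 'X_2 + (A 1 j)%:MP * crB th X Y 'X_2.
Proof.
move=> th X Y.
have hX : X \is 1.-homog by apply: affine_lin_homog.
have hY : Y \is 1.-homog by apply: affine_lin_homog.
rewrite -[RHS](@dehomogenizeK _ 3); last first.
  by apply: rpredD; apply: dhomogCM; rewrite ?crA_homog ?crB_homog ?dhomogX1.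
congr homogenize; rewrite /pullback cr16PE cr16QE.
set th0 := Params a b c d e 1 k l m n p q.
have [hA hB _] := dehomogenize_cr th0 X Y.
have -> (u v : C) (P Q : {mpoly C[3]}) :
    dehomogenize (u%:MP * P + v%:MP * Q) =
    u *: dehomogenize P + v *: dehomogenize Q.
  by rewrite /dehomogenize rmorphD !rmorphM /= !comp_mpolyC !mul_mpolyC.
rewrite hA hB !dehomogenize_affine_lin.
have thE : map_params (comp_mpoly (affine_map A t)) (cstp 2 th0) = cstp 2 th0.
  by rewrite /map_params /= !comp_mpolyC.
have XE i : 'X_i \mPo affine_map A t = (affine_map A t)`_i by apply: comp_mpolyXU.
by congr (_ *: _ + _ *: _); [rewrite [LHS]rmorph_crA | rewrite [LHS]rmorph_crB];
  rewrite thE; congr (_ _ _ _ _); try exact: XE; apply: comp_mpoly1.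
Qed.
End Dehomogenize.

(** * Integral curves of a general form of the family *)

Section IntegralCurves.
Variable C : fieldType.
Implicit Types (w : V3 C) (F K : {mpoly C[3]}).

Lemma mderivXU (i j : 'I_3) : ('X_j : {mpoly C[3]})^`M(i) = (i == j)%:R.
Proof.
rewrite mderivX mnm1E eq_sym; case: eqP => [->|_]; last by rewrite scale0r.
rewrite scale1r (_ : _ - _ = 0)%MM ?mpolyX0 //.
by apply/mnmP => k; rewrite mnmBE subnn mnm0E.
Qed.

Lemma cofactor_scale w F K (c : C) : c != 0 -> K \is 2.-homog ->
  c%:MP * (coefP w * F^`M(1) - coefQ w * F^`M(0)) = - (F * K) ->
  Defs.cofactor w F (c^-1 *: K).
Proof.
move=> c0 hK e; split; first exact: rpredZ.
rewrite -scalerAr -scalerN -e mul_mpolyC scalerA mulVf //.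
by rewrite scale1r.
Qed.

(** The two groups of terms on the right are [c] times the cofactor of [F] and,
    when [u M_y + v M_x = (n + p) M], [c] times the cofactor of [M]. *)
Lemma curl_log_form (P Q F M u v : {mpoly C[3]}) (c n p : C) :
  c%:MP * P = F * u + M * F^`M(0) -> c%:MP * Q = - (F * v) + M * F^`M(1) ->
  u^`M(1) = p%:MP -> v^`M(0) = n%:MP ->
  c%:MP * (Q^`M(0) - P^`M(1)) =
  - (u * F^`M(1) + v * F^`M(0))
  - ((n + p)%:MP * F + (F^`M(0) * M^`M(1) - F^`M(1) * M^`M(0))).
Proof.
move=> eP eQ uY vX; rewrite mulrBr -!mderiv_mulC eP eQ.
rewrite !mderivD mderivN !mderivM uY vX (mderiv_comm 0 1).
ring.
Qed.

End IntegralCurves.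

Ltac mderiv_simpl :=
  rewrite ?expr2 !(mderivD, mderivN, mderivM, mderivC, mderivXU) /=.

Ltac meval_simpl :=
  rewrite ?expr2 !(mevalD, mevalN, mevalM, mevalC, mevalXU) /=.

Section GeneralForm.
Variable C : fieldType.
Variable th : params C.
Variable w : V3 C.
Let cth := cstp 3 th.
Hypothesis wP : coefP w = crA cth 'X_0 'X_1 'X_2.
Hypothesis wQ : coefQ w = crB cth 'X_0 'X_1 'X_2.
Hypothesis D0 : crD th != 0.
Hypothesis m0 : pm th != 0.
Hypothesis t0 : pt th != 0.
Let F := crF cth 'X_0 'X_1 'X_2.
Let M := crM cth 'X_0 'X_1.

Lemma crD_cst : crD cth = (crD th)%:MP.
Proof. rewrite /crD /=; ring. Qed.

Let FX : F^`M(0) = crFX cth 'X_0 'X_1 'X_2.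
Proof.
rewrite /F /crF /crFX /crT /crTX /crD /=; mderiv_simpl; ring.
Qed.

Let FY : F^`M(1) = crFY cth 'X_0 'X_1 'X_2.
Proof.
rewrite /F /crF /crFY /crT /crTY /crD /=; mderiv_simpl; ring.
Qed.

Let MX : M^`M(0) = (pn th - pp th)%:MP * 'X_1 - (2 * pq th)%:MP * 'X_0.
Proof. rewrite /M /crM /crU /crV /=; mderiv_simpl; ring. Qed.

Let MY : M^`M(1) = (pn th - pp th)%:MP * 'X_0 + (2 * pm th)%:MP * 'X_1.
Proof. rewrite /M /crM /crU /crV /=; mderiv_simpl; ring. Qed.

Let KF := - (crU cth 'X_0 'X_1 * F^`M(1) + crV cth 'X_0 'X_1 * F^`M(0)).
Let KM := - ((pn th + pp th)%:MP * F + (F^`M(0) * M^`M(1) - F^`M(1) * M^`M(0))).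

Let F_homog : F \is 2.-homog.
Proof. by apply: crF_homog; apply: dhomogX1. Qed.

Let FX_homog : F^`M(0) \is 1.-homog.
Proof.
rewrite FX /crFX /crTX crD_cst /= -mpolyC_nat -!mpolyCM -mpolyCB.
solve_homog.
Qed.

Let FY_homog : F^`M(1) \is 1.-homog.
Proof.
rewrite FY /crFY /crTY crD_cst /= -mpolyC_nat -!mpolyCM -mpolyCB.
solve_homog.
Qed.

Let MX_homog : M^`M(0) \is 1.-homog.
Proof. rewrite MX; solve_homog. Qed.

Let MY_homog : M^`M(1) \is 1.-homog.
Proof. rewrite MY; solve_homog. Qed.

Lemma cr16_cofactor_conic : Defs.cofactor w F ((crD th)^-1 *: KF).
Proof.
apply: cofactor_scale => //.
  rewrite /KF /crU /crV /=; solve_homog.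
rewrite -crD_cst mulrBr !mulrA wP wQ crA_factor crB_factor -FX -FY -/F /KF.
ring.
Qed.

(** On [M = 0] the contraction of [omega] with the Euler field vanishes; the
    constant [n + p] appears because [M_y U + M_x V = (n + p) M]. *)
Lemma cr16_cofactor_lines : Defs.cofactor w M ((crD th)^-1 *: KM).
Proof.
apply: cofactor_scale => //.
  rewrite /KM; solve_homog.
rewrite -crD_cst mulrBr !mulrA wP wQ crA_factor crB_factor -FX -FY -/F -/M /KM.
rewrite MX MY /M /crM /crU /crV /=; ring.
Qed.

Let F_neq0 : F != 0.
Proof.
apply: contra_neq (mulf_neq0 D0 t0) => F0.
have : F.@[fun i => (i == 2)%:R] = 0 by rewrite F0 meval0.
rewrite /F /crF /crT crD_cst /=.
meval_simpl => e.
rewrite -[RHS]e; ring.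
Qed.

Let M_neq0 : M != 0.
Proof.
apply: contra_neq m0 => M0.
have : M.@[fun i => (i == 1)%:R] = 0 by rewrite M0 meval0.
rewrite /M /crM /crU /crV /=.
meval_simpl => e.
rewrite -[RHS]e; ring.
Qed.

Lemma cr16_integral_conic : integral_curve w 2 F.
Proof. by split=> //; exists ((crD th)^-1 *: KF); apply: cr16_cofactor_conic. Qed.

Lemma cr16_darboux : darboux_integrable w.
Proof.
exists 2%N, (fun i => if i == 0 then F else M),
  (fun i => if i == 0 then (crD th)^-1 *: KF else (crD th)^-1 *: KM), (fun=> 1).
split=> [i|].
  case: ifP => _; split; [by exists 2%N | exact: cr16_cofactor_conic| |
     exact: cr16_cofactor_lines].
  exists 2%N; split=> //; rewrite /M /crM /crU /crV /=; solve_homog.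
rewrite !big_ord_recl big_ord0 addr0 !scale1r /= -scalerDr.
apply: (canRL (scalerK D0)).
rewrite -mul_mpolyC; apply: curl_log_form.
- by rewrite wP -crD_cst crA_factor -FX.
- by rewrite wQ -crD_cst crB_factor -FY.
- by rewrite /crU /=; mderiv_simpl; ring.
- by rewrite /crV /=; mderiv_simpl; ring.
Qed.
End GeneralForm.

(** [D <> 0] makes the conic a genuine curve, and [m <> 0] the pair of lines. *)
Lemma cr16_generic_open (C : numFieldType) :
  exists U : 'rV[C]_11 -> Prop,
     [/\ zariski_open U, (exists v, U v)
       & forall a b c d e k l m n p q : C,
           U (\row_(i < 11) [:: a; b; c; d; e; k; l; m; n; p; q]`_i) ->
           m != 0 /\ m * q - n * p != 0].
Proof.
pose g : {mpoly C[11]} :=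
  'X_7 * ('X_7 * 'X_10 - 'X_8 * 'X_9).
have gE (v : 'rV[C]_11) :
    g.@[v 0] = v 0 7 * (v 0 7 * v 0 10 - v 0 8 * v 0 9).
  by rewrite /g !(mevalM, mevalB, mevalXU).
exists (fun v => g.@[v 0] != 0); split.
- exists (fun f => f = g) => v; split=> [/negP|/(_ _ erefl) ->]; last by rewrite eqxx.
  by rewrite negbK => /eqP gv _ ->.
- exists (\row_(i < 11) (i \in [:: 7; 10])%:R).
  by rewrite gE !mxE /= mulr0 subr0 !mulr1 oner_eq0.
- move=> a b c d e k l m n p q; rewrite gE !mxE /= mulf_eq0 negb_or.
  by move=> /andP[].
Qed.

(** * Zariski closure along a polynomial curve *)

Section PolynomialFunctions.
Variable C : fieldType.

Definition polyfun (g : C -> C) : Prop := exists p : {poly C}, forall s, g s = p.[s].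

Lemma polyfun_cst c : polyfun (fun=> c).
Proof. by exists c%:P => s; rewrite hornerC. Qed.

Lemma polyfun_id : polyfun id.
Proof. by exists 'X => s; rewrite hornerX. Qed.

Lemma polyfunD f g : polyfun f -> polyfun g -> polyfun (fun s => f s + g s).
Proof. by move=> [p fE] [q gE]; exists (p + q) => s; rewrite hornerD fE gE. Qed.

Lemma polyfunN f : polyfun f -> polyfun (fun s => - f s).
Proof. by move=> [p fE]; exists (- p) => s; rewrite hornerN fE. Qed.

Lemma polyfunM f g : polyfun f -> polyfun g -> polyfun (fun s => f s * g s).
Proof. by move=> [p fE] [q gE]; exists (p * q) => s; rewrite hornerM fE gE. Qed.

Lemma polyfunX f n : polyfun f -> polyfun (fun s => f s ^+ n).
Proof. by move=> [p fE]; exists (p ^+ n) => s; rewrite horner_exp fE. Qed.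

Lemma polyfun_sum (I : Type) (r : seq I) (P : pred I) (f : I -> C -> C) :
  (forall i, P i -> polyfun (f i)) -> polyfun (fun s => \sum_(i <- r | P i) f i s).
Proof.
move=> hf; elim: r => [|i r [p pE]].
  by exists 0 => s; rewrite big_nil horner0.
case Pi: (P i); last by exists p => s; rewrite big_cons Pi pE.
have [q qE] := hf i Pi; exists (q + p) => s.
by rewrite big_cons Pi hornerD qE pE.
Qed.

Definition interp (x y s : C) : C := x * (1 - s) + y * s.

Lemma polyfun_interp x y : polyfun (interp x y).
Proof.
rewrite /interp; apply: polyfunD; apply: polyfunM; try exact: polyfun_cst.
  by apply: polyfunD; [exact: polyfun_cst | apply: polyfunN; exact: polyfun_id].
exact: polyfun_id.
Qed.

Lemma interp0 x y : interp x y 0 = x.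
Proof. by rewrite /interp; ring. Qed.

Lemma interp1 x y : interp x y 1 = y.
Proof. by rewrite /interp; ring. Qed.

(** A polynomial curve in the space of polynomials in [n] variables. *)
Definition polyfamily n (P : C -> {mpoly C[n]}) : Prop :=
  forall m, polyfun (fun s => (P s)@_m).

Variable n : nat.
Implicit Types P Q : C -> {mpoly C[n]}.

Lemma polyfamily_cst p : polyfamily (fun=> p : {mpoly C[n]}).
Proof. by move=> m; apply: polyfun_cst. Qed.

Lemma polyfun_ext f g : f =1 g -> polyfun f -> polyfun g.
Proof. by move=> fg [p fE]; exists p => s; rewrite -fg fE. Qed.

Lemma polyfamilyC f : polyfun f -> polyfamily (fun s => (f s)%:MP : {mpoly C[n]}).
Proof.
move=> hf m; apply: (@polyfun_ext (fun s => f s * (m == 0%MM)%:R)).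
  by move=> s; rewrite mcoeffC eq_sym.
by apply: polyfunM => //; apply: polyfun_cst.
Qed.

Lemma polyfamilyD P Q : polyfamily P -> polyfamily Q -> polyfamily (fun s => P s + Q s).
Proof.
move=> hP hQ m; apply: (@polyfun_ext (fun s => (P s)@_m + (Q s)@_m)).
  by move=> s; rewrite mcoeffD.
exact: polyfunD.
Qed.

Lemma polyfamilyN P : polyfamily P -> polyfamily (fun s => - P s).
Proof.
move=> hP m; apply: (@polyfun_ext (fun s => - (P s)@_m)).
  by move=> s; rewrite mcoeffN.
exact: polyfunN.
Qed.

Lemma polyfamilyM P Q : polyfamily P -> polyfamily Q -> polyfamily (fun s => P s * Q s).
Proof.
move=> hP hQ m.
apply: (@polyfun_ext (fun s => \sum_(k : 'X_{1..n < (mdeg m).+1, (mdeg m).+1}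
    | m == (k.1 + k.2)%MM) (P s)@_k.1 * (Q s)@_k.2)).
  by move=> s; rewrite mcoeffM.
by apply: polyfun_sum => k _; apply: polyfunM.
Qed.

Lemma polyfun_meval k (f : {mpoly C[k]}) (v : C -> 'I_k -> C) :
  (forall i, polyfun (fun s => v s i)) -> polyfun (fun s => f.@[v s]).
Proof.
move=> hv; apply: (@polyfun_ext (fun s =>
   \sum_(m <- msupp f) f@_m * \prod_(i < k) v s i ^+ m i)).
  by move=> s; rewrite mevalE.
apply: polyfun_sum => m _; apply: polyfunM; first exact: polyfun_cst.
elim: (index_enum _) => [|i r [p pE]].
  by exists 1 => s; rewrite big_nil hornerC.
have [q qE] := polyfunX (m i) (hv i).
by exists (q * p) => s; rewrite big_cons hornerM -qE -pE.
Qed.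

End PolynomialFunctions.

Section Closure.

Lemma coordinates_polyfun (C : fieldType) (w : C -> V3 C) i :
  polyfamily (fun s => coefP (w s)) -> polyfamily (fun s => coefQ (w s)) ->
  polyfun (fun s => coordinates (w s) 0 i).
Proof.
pose mono (m : 'X_{1..3 < 4}) : dhomog 3 C 3 := insubd 0 ('X_[m] : {mpoly C[3]}).
have monoE (p : dhomog 3 C 3) :
    p = \sum_(m : 'X_{1..3 < 4} | mdeg m == 3) (p : {mpoly C[3]})@_m *: mono m.
  apply: val_inj; rewrite /= raddf_sum /=.
  have hp : (p : {mpoly C[3]}) \is 3.-homog by apply: dhomog_is_dhomog.
  rewrite -[LHS](pihomog_dE hp) (@pihomogwE _ _ _ _ 4) //=; last first.
    rewrite msizeE; apply/bigmax_leqP_seq => m mp _.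
    by rewrite (dhomogP _ _ _ hp).
  apply: eq_bigr => m dm; congr (_ *: _).
  rewrite -[RHS]/(val (mono m)) [RHS]val_insubd.
  by rewrite [_ \in _]dhomogX dm.
move=> hP hQ; pose l (u : V3 C) := coord (vbasis {:V3 C}) i u.
apply: (@polyfun_ext _ (fun s =>
   \sum_(m : 'X_{1..3 < 4} | mdeg m == 3) ((coefP (w s))@_m * l (mono m, 0)
      + (coefQ (w s))@_m * l (0, mono m)))).
  move=> s; rewrite mxE -/(l _).
  have wE : w s = \sum_(m : 'X_{1..3 < 4} | mdeg m == 3)
     ((coefP (w s))@_m *: (mono m, 0) + (coefQ (w s))@_m *: (0, mono m)).
    case: (w s) => p q; rewrite /coefP /coefQ /=.
    rewrite [in LHS](monoE p) [in LHS](monoE q).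
    rewrite -[LHS]/(\sum_(m : 'X_{1..3 < 4} | mdeg m == 3) p@_m *: mono m,
      \sum_(m : 'X_{1..3 < 4} | mdeg m == 3) q@_m *: mono m).
    rewrite (eq_bigr (fun m : 'X_{1..3 < 4} => (p@_m *: mono m, q@_m *: mono m))).
      by apply: (big_rec3 (fun x y z => (x, y) = z)) => // m x y z _ <-.
    by move=> m _; congr pair; rewrite /= scaler0 ?addr0 ?add0r.
  rewrite [in RHS]wE /l linear_sum /=; apply: eq_bigr => m _.
  by rewrite linearD !linearZ.
by apply: polyfun_sum => m _; apply: polyfunD; apply: polyfunM;
  rewrite //; apply: polyfun_cst.
Qed.

Lemma poly_eq0_of_horner (C : numFieldType) (p : {poly C}) :
  (forall s, p.[s] = 0) -> p = 0.
Proof.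
move=> hp; apply: contraTeq isT => p0.
have := @max_poly_roots _ p [seq i%:R | i <- iota 0 (size p)] p0.
rewrite size_map size_iota ltnn; apply.
  by apply/allP => x _; rewrite /root hp.
rewrite map_inj_in_uniq ?iota_uniq // => i j _ _ /eqP.
by rewrite eqr_nat => /eqP.
Qed.

(** If [f] vanishes on [S], then [f (w s) * g s] vanishes for every [s]; as a
    polynomial in [s] with a nonzero factor [g], it forces [f (w s)] to be zero
    identically, in particular at [s = 0]. *)
Lemma closure_of_polynomial_curve (C : numFieldType) (S : V3 C -> Prop)
    (w : C -> V3 C) (g : C -> C) (s1 : C) :
  polyfamily (fun s => coefP (w s)) -> polyfamily (fun s => coefQ (w s)) ->
  polyfun g -> g s1 != 0 -> (forall s, g s != 0 -> S (w s)) ->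
  zariski_closure S (w 0).
Proof.
move=> hP hQ [q gE] g1 hS Z [I ZE] hZ.
apply/ZE => f fI.
have [i|p pE] := @polyfun_meval _ _ f (fun s => coordinates (w s) 0).
  exact: coordinates_polyfun.
rewrite pE; suff -> : p = 0 by rewrite horner0.
have: p * q = 0.
  apply: poly_eq0_of_horner => s; rewrite hornerM -pE -gE.
  have [->|gs] := eqVneq (g s) 0; first by rewrite mulr0.
  by have /ZE/(_ f fI) -> := hZ _ (hS s gs); rewrite mul0r.
move/eqP; rewrite mulf_eq0 => /orP[/eqP //|/eqP q0].
by rewrite gE q0 horner0 eqxx in g1.
Qed.
End Closure.

(** * Lines and conics in general position *)

Record line (K : Type) := Line { l1 : K; l2 : K; l3 : K }.
Record conic (K : Type) := Conic
  { f11 : K; f12 : K; f22 : K; f13 : K; f23 : K; f33 : K }.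

Section LinesAndConics.
Variable K : comNzRingType.
Implicit Types (l m : line K) (f : conic K) (X Y Z : K).

Definition line_eq l X Y Z : K := l1 l * X + l2 l * Y + l3 l * Z.
Definition conic_eq f X Y Z : K :=
  f11 f * X ^+ 2 + f12 f * X * Y + f22 f * Y ^+ 2
  + f13 f * X * Z + f23 f * Y * Z + f33 f * Z ^+ 2.
Definition conicX f X Y Z : K := 2 * f11 f * X + f12 f * Y + f13 f * Z.
Definition conicY f X Y Z : K := f12 f * X + 2 * f22 f * Y + f23 f * Z.
Definition conicZ f X Y Z : K := f13 f * X + f23 f * Y + 2 * f33 f * Z.

(** Half of the determinant of the Hessian matrix. *)
Definition conic_det f : K :=
  4 * f11 f * f22 f * f33 f + f12 f * f13 f * f23 f
  - f11 f * f23 f ^+ 2 - f22 f * f13 f ^+ 2 - f33 f * f12 f ^+ 2.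

(** Its matrix is the adjugate of the Hessian matrix of [f]: it vanishes on the
    lines tangent to [f]. *)
Definition dual_conic f : conic K :=
  {| f11 := 4 * f22 f * f33 f - f23 f ^+ 2;
     f12 := 2 * (f13 f * f23 f - 2 * f12 f * f33 f);
     f22 := 4 * f11 f * f33 f - f13 f ^+ 2;
     f13 := 2 * (f12 f * f23 f - 2 * f22 f * f13 f);
     f23 := 2 * (f12 f * f13 f - 2 * f11 f * f23 f);
     f33 := 4 * f11 f * f22 f - f12 f ^+ 2 |}.

Definition tangency f l : K := conic_eq (dual_conic f) (l1 l) (l2 l) (l3 l).

(** The last coordinate of the intersection point of [l] and [m]. *)
Definition line_cross l m : K := l1 l * l2 m - l2 l * l1 m.

Definition conic_at_meet f l m : K :=
  conic_eq f (l2 l * l3 m - l3 l * l2 m) (l3 l * l1 m - l1 l * l3 m)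
    (line_cross l m).

Definition conic_at_infinity f l : K := conic_eq f (l2 l) (- l1 l) 0.

Definition infinity_line : line K := Line 0 0 1.

(** The factors say that the conic is smooth and not tangent to the line at
    infinity, that the lines meet at a finite point, that they are not tangent
    to the conic, that neither meets it at infinity, and that it avoids their
    intersection point. *)
Definition general_position f l m : K :=
  conic_det f * tangency f infinity_line * line_cross l m
  * (tangency f l * tangency f m)
  * (conic_at_infinity f l * conic_at_infinity f m) * conic_at_meet f l m.
End LinesAndConics.

Lemma rank_lt2_minors (C : fieldType) n (u v : 'rV[C]_n) i j :
  (\rank (col_mx u v) < 2)%N -> u 0 i * v 0 j = u 0 j * v 0 i.
Proof.
move=> rk; have : kermx (col_mx u v) != 0.
  by rewrite kermx_eq0 /row_free neq_ltn rk.
case/rowV0Pn => a /sub_kermxP; rewrite -[a]hsubmxK mul_row_col.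
rewrite [lsubmx a]mx11_scalar [rsubmx a]mx11_scalar !mul_scalar_mx.
set x := lsubmx a 0 0; set y := rsubmx a 0 0 => e a0.
have ek k : x * u 0 k + y * v 0 k = 0.
  by have := congr1 (fun b : 'rV_n => b 0 k) e; rewrite !mxE.
suff [ex ey] : x * (u 0 i * v 0 j - u 0 j * v 0 i) = 0 /\
   y * (u 0 i * v 0 j - u 0 j * v 0 i) = 0.
  apply/eqP; rewrite -subr_eq0; apply: contra_neqT a0 => d0.
  move/eqP: ex; rewrite mulf_eq0 (negPf d0) orbF => /eqP ->.
  move/eqP: ey; rewrite mulf_eq0 (negPf d0) orbF => /eqP ->.
  by rewrite !raddf0 row_mx0.
split.
- have -> : x * (u 0 i * v 0 j - u 0 j * v 0 i) =
      v 0 j * (x * u 0 i + y * v 0 i) - v 0 i * (x * u 0 j + y * v 0 j) by ring.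
  by rewrite !ek; ring.
- have -> : y * (u 0 i * v 0 j - u 0 j * v 0 i) =
      u 0 i * (x * u 0 j + y * v 0 j) - u 0 j * (x * u 0 i + y * v 0 i) by ring.
  by rewrite !ek; ring.
Qed.

Definition cst_line (C : fieldType) (l : line C) : line {mpoly C[3]} :=
  Line (l1 l)%:MP (l2 l)%:MP (l3 l)%:MP.
Definition cst_conic (C : fieldType) (f : conic C) : conic {mpoly C[3]} :=
  Conic (f11 f)%:MP (f12 f)%:MP (f22 f)%:MP (f13 f)%:MP (f23 f)%:MP (f33 f)%:MP.

Section Evaluation.
Variable C : fieldType.
Implicit Types (X Y Z : {mpoly C[3]}) (v : 'I_3 -> C).

Lemma meval_line_eq l X Y Z v :
  (line_eq (cst_line l) X Y Z).@[v] = line_eq l X.@[v] Y.@[v] Z.@[v].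
Proof. by rewrite /line_eq /=; meval_simpl. Qed.

Lemma meval_conic_eq f X Y Z v :
  (conic_eq (cst_conic f) X Y Z).@[v] = conic_eq f X.@[v] Y.@[v] Z.@[v].
Proof. by rewrite /conic_eq /=; meval_simpl. Qed.

Lemma meval_conicX f X Y Z v :
  (conicX (cst_conic f) X Y Z).@[v] = conicX f X.@[v] Y.@[v] Z.@[v].
Proof.
rewrite /conicX /= -mpolyC_nat -mpolyCM.
by meval_simpl.
Qed.

Lemma meval_conicY f X Y Z v :
  (conicY (cst_conic f) X Y Z).@[v] = conicY f X.@[v] Y.@[v] Z.@[v].
Proof.
rewrite /conicY /= -mpolyC_nat -mpolyCM.
by meval_simpl.
Qed.

Lemma meval_conicZ f X Y Z v :
  (conicZ (cst_conic f) X Y Z).@[v] = conicZ f X.@[v] Y.@[v] Z.@[v].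
Proof.
rewrite /conicZ /= -mpolyC_nat -mpolyCM.
by meval_simpl.
Qed.
Lemma mderiv_conic_eq f X Y Z i :
  (conic_eq (cst_conic f) X Y Z)^`M(i) =
  conicX (cst_conic f) X Y Z * X^`M(i) + conicY (cst_conic f) X Y Z * Y^`M(i)
  + conicZ (cst_conic f) X Y Z * Z^`M(i).
Proof.
rewrite /conic_eq /conicX /conicY /conicZ /= !expr2.
by rewrite !(mderivD, mderivM, mderivC); ring.
Qed.

Lemma mderiv_line_eq l X Y Z i :
  (line_eq (cst_line l) X Y Z)^`M(i) =
  (l1 l)%:MP * X^`M(i) + (l2 l)%:MP * Y^`M(i) + (l3 l)%:MP * Z^`M(i).
Proof. by rewrite /line_eq /= !(mderivD, mderivM, mderivC); ring. Qed.

Lemma line_eq_homog l X Y Z : X \is 1.-homog -> Y \is 1.-homog ->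
  Z \is 1.-homog -> line_eq (cst_line l) X Y Z \is 1.-homog.
Proof. by move=> hX hY hZ; rewrite /line_eq /=; solve_homog. Qed.

Lemma conic_eq_homog f X Y Z : X \is 1.-homog -> Y \is 1.-homog ->
  Z \is 1.-homog -> conic_eq (cst_conic f) X Y Z \is 2.-homog.
Proof. by move=> hX hY hZ; rewrite /conic_eq /=; solve_homog. Qed.

Lemma mderiv_affine_lin (a b c : C) :
  [/\ (affine_lin a b c)^`M(0) = a%:MP, (affine_lin a b c)^`M(1) = b%:MP &
      (affine_lin a b c)^`M(2) = c%:MP].
Proof. by rewrite /affine_lin; split; mderiv_simpl; ring. Qed.
End Evaluation.

(** Curves are given by their equations in affine coordinates [S], [R]; the
    criteria do not change under an affine change of coordinates. *)
Section AdaptedCoordinates.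
Variable C : numFieldType.
Variables s1 s2 s3 r1 r2 r3 : C.
Hypothesis det0 : s1 * r2 - s2 * r1 != 0.
Let S : {mpoly C[3]} := affine_lin s1 s2 s3.
Let R : {mpoly C[3]} := affine_lin r1 r2 r3.

Definition line_poly (l : line C) : {mpoly C[3]} := line_eq (cst_line l) S R 'X_2.
Definition conic_poly (f : conic C) : {mpoly C[3]} := conic_eq (cst_conic f) S R 'X_2.

Lemma line_poly_homog l : line_poly l \is 1.-homog.
Proof. by apply: line_eq_homog; rewrite ?affine_lin_homog ?dhomogX1. Qed.

Lemma conic_poly_homog f : conic_poly f \is 2.-homog.
Proof. by apply: conic_eq_homog; rewrite ?affine_lin_homog ?dhomogX1. Qed.

Lemma mderiv_line_poly l :
  [/\ (line_poly l)^`M(0) = (s1 * l1 l + r1 * l2 l)%:MP,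
      (line_poly l)^`M(1) = (s2 * l1 l + r2 * l2 l)%:MP &
      (line_poly l)^`M(2) = (s3 * l1 l + r3 * l2 l + l3 l)%:MP].
Proof.
have [S0 S1 S2] := mderiv_affine_lin s1 s2 s3.
have [R0 R1 R2] := mderiv_affine_lin r1 r2 r3.
rewrite /line_poly; split; rewrite mderiv_line_eq mderivXU /=.
- by rewrite S0 R0; ring.
- by rewrite S1 R1; ring.
- by rewrite S2 R2; ring.
Qed.

Lemma mderiv_conic_poly f :
  let fX := conicX (cst_conic f) S R 'X_2 in
  let fY := conicY (cst_conic f) S R 'X_2 in
  [/\ (conic_poly f)^`M(0) = s1%:MP * fX + r1%:MP * fY,
      (conic_poly f)^`M(1) = s2%:MP * fX + r2%:MP * fY &
      (conic_poly f)^`M(2) =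
        s3%:MP * fX + r3%:MP * fY + conicZ (cst_conic f) S R 'X_2].
Proof.
have [S0 S1 S2] := mderiv_affine_lin s1 s2 s3.
have [R0 R1 R2] := mderiv_affine_lin r1 r2 r3.
move=> fX fY; rewrite /conic_poly; split; rewrite mderiv_conic_eq mderivXU /=.
- by rewrite -/fX -/fY S0 R0; ring.
- by rewrite -/fX -/fY S1 R1; ring.
- by rewrite -/fX -/fY S2 R2; ring.
Qed.

Section AtPoint.
Variable p : 'rV[C]_3.
Let x := s1 * p 0 0 + s2 * p 0 1 + s3 * p 0 2.
Let y := r1 * p 0 0 + r2 * p 0 1 + r3 * p 0 2.
Let z := p 0 2.

Lemma meval_SR : S.@[p 0] = x /\ R.@[p 0] = y.
Proof. by rewrite /S /R /affine_lin; meval_simpl. Qed.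

Lemma meval_line l : (line_poly l).@[p 0] = line_eq l x y z.
Proof.
have [Sp Rp] := meval_SR.
by rewrite /line_poly meval_line_eq Sp Rp mevalXU.
Qed.

Lemma meval_conic f : (conic_poly f).@[p 0] = conic_eq f x y z.
Proof.
have [Sp Rp] := meval_SR.
by rewrite /conic_poly meval_conic_eq Sp Rp mevalXU.
Qed.

(** The gradient [g] in the coordinates [x], [y], [z] of a polynomial whose
    gradient in the coordinates [S], [R], [z] is [(g1, g2, g3)]. *)
Definition adapted_gradient (g : 'rV[C]_3) (g1 g2 g3 : C) :=
  [/\ g 0 0 = s1 * g1 + r1 * g2, g 0 1 = s2 * g1 + r2 * g2 & g 0 2 = s3 * g1 + r3 * g2 + g3].

Lemma gradient_line l :
  adapted_gradient (gradient (line_poly l) p) (l1 l) (l2 l) (l3 l).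
Proof.
have [d0 d1 d2] := mderiv_line_poly l.
by split; rewrite mxE ?d0 ?d1 ?d2 mevalC.
Qed.

Lemma gradient_conic f :
  adapted_gradient (gradient (conic_poly f) p)
    (conicX f x y z) (conicY f x y z) (conicZ f x y z).
Proof.
have [d0 d1 d2] := mderiv_conic_poly f; have [Sp Rp] := meval_SR.
have fXp := meval_conicX f S R 'X_2 (p 0).
have fYp := meval_conicY f S R 'X_2 (p 0).
have fZp := meval_conicZ f S R 'X_2 (p 0).
rewrite Sp Rp mevalXU in fXp fYp fZp.
have e2 (a b : C) (U V : {mpoly C[3]}) :
    (a%:MP * U + b%:MP * V).@[p 0] = a * U.@[p 0] + b * V.@[p 0].
  by meval_simpl.
by split; rewrite mxE; [rewrite d0 e2 fXp fYp | rewrite d1 e2 fXp fYp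
  | rewrite d2 mevalD e2 fXp fYp fZp].
Qed.

Lemma adapted_minors g h g1 g2 g3 h1 h2 h3 :
  adapted_gradient g g1 g2 g3 -> adapted_gradient h h1 h2 h3 ->
  (\rank (col_mx g h) < 2)%N ->
  [/\ g1 * h2 - g2 * h1 = 0, g1 * h3 - g3 * h1 = 0 & g2 * h3 - g3 * h2 = 0].
Proof.
move=> [g0E g1E g2E] [h0E h1E h2E] rk.
have m01 := rank_lt2_minors 0 1 rk; have m02 := rank_lt2_minors 0 2 rk.
have m12 := rank_lt2_minors 1 2 rk.
rewrite g0E g1E g2E h0E h1E h2E in m01 m02 m12.
have m012 : g1 * h2 - g2 * h1 = 0.
  apply: (mulfI det0); rewrite mulr0.
  by move/eqP: m01; rewrite -subr_eq0 => /eqP <-; ring.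
have e1 : s1 * (g1 * h3 - g3 * h1) + r1 * (g2 * h3 - g3 * h2) = 0.
  move/eqP: m02; rewrite -subr_eq0 => /eqP m02.
  set e := (X in X = 0) in m02.
  transitivity (e - (s1 * r3 - s3 * r1) * (g1 * h2 - g2 * h1)).
    by rewrite /e; ring.
  by rewrite m02 m012; ring.
have e2 : s2 * (g1 * h3 - g3 * h1) + r2 * (g2 * h3 - g3 * h2) = 0.
  move/eqP: m12; rewrite -subr_eq0 => /eqP m12.
  set e := (X in X = 0) in m12.
  transitivity (e - (s2 * r3 - s3 * r2) * (g1 * h2 - g2 * h1)).
    by rewrite /e; ring.
  by rewrite m12 m012; ring.
split=> //; apply: (mulfI det0); rewrite mulr0.
- set e := (X in X = 0) in e1; set e' := (X in X = 0) in e2.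
  transitivity (r2 * e - r1 * e'); first by rewrite /e /e'; ring.
  by rewrite e1 e2; ring.
- set e := (X in X = 0) in e1; set e' := (X in X = 0) in e2.
  transitivity (s1 * e' - s2 * e); first by rewrite /e /e'; ring.
  by rewrite e1 e2; ring.
Qed.

(** A point of the projective plane has a nonzero coordinate.  Each criterion
    below is a polynomial in the coefficients of the curves that is shown in
    this way to vanish when the forbidden point exists. *)
Lemma annihilated_point c :
  p != 0 -> c * x ^+ 2 = 0 -> c * y ^+ 2 = 0 -> c * z ^+ 2 = 0 -> c = 0.
Proof.
move=> p0 cx cy cz; apply/eqP; apply: contra_neqT p0 => c0.
have sq0 t : c * t ^+ 2 = 0 -> t = 0.
  by move/eqP; rewrite mulf_eq0 (negPf c0) expf_eq0 => /eqP.
move: cx cy cz => /sq0 x0 /sq0 y0 /sq0 z0.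
have e0 : p 0 0 = 0.
  apply: (mulfI det0); rewrite mulr0.
  have -> : (s1 * r2 - s2 * r1) * p 0 0 =
      r2 * x - s2 * y + (s2 * r3 - s3 * r2) * z by rewrite /x /y /z; ring.
  by rewrite x0 y0 z0; ring.
have e1 : p 0 1 = 0.
  apply: (mulfI det0); rewrite mulr0.
  have -> : (s1 * r2 - s2 * r1) * p 0 1 =
      s1 * y - r1 * x + (r1 * s3 - s1 * r3) * z by rewrite /x /y /z; ring.
  by rewrite x0 y0 z0; ring.
apply/rowP => i; rewrite mxE; case: i => [[|[|[|//]]] hi].
- by rewrite -[RHS]e0; congr (p _ _); apply: val_inj.
- by rewrite -[RHS]e1; congr (p _ _); apply: val_inj.
- by rewrite -[RHS]z0; congr (p _ _); apply: val_inj.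
Qed.
End AtPoint.

Lemma infinity_line_poly : line_poly (infinity_line C) = 'X_2.
Proof. by rewrite /line_poly /line_eq /=; ring. Qed.

(** Cramer's rule: the gradient of a conic is linear in the point. *)
Lemma conic_poly_smooth f : conic_det f != 0 -> smooth_curve (conic_poly f).
Proof.
move=> d0 p p0 _; apply/negP => /eqP g0.
have [] := gradient_conic p f; rewrite g0 !mxE.
set x := s1 * p 0 0 + _ + _; set y := r1 * p 0 0 + _ + _; set z := p 0 2.
set fX := conicX _ _ _ _; set fY := conicY _ _ _ _ => ex ey ez'.
have fX0 : fX = 0.
  apply: (mulfI det0); rewrite mulr0.
  have -> : (s1 * r2 - s2 * r1) * fX =
    r2 * (s1 * fX + r1 * fY) - r1 * (s2 * fX + r2 * fY) by ring.
  by rewrite -ex -ey; ring.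
have fY0 : fY = 0.
  apply: (mulfI det0); rewrite mulr0.
  have -> : (s1 * r2 - s2 * r1) * fY =
    s1 * (s2 * fX + r2 * fY) - s2 * (s1 * fX + r1 * fY) by ring.
  by rewrite -ex -ey; ring.
have ez : 0 = conicZ f x y z by move: ez'; rewrite fX0 fY0 !mulr0 !add0r.
have : 2 * conic_det f = 0.
  apply: (annihilated_point p0).
  - have -> : 2 * conic_det f * x ^+ 2 =
      x * ((4 * f22 f * f33 f - f23 f ^+ 2) * fX
      + (f13 f * f23 f - 2 * f12 f * f33 f) * fY
      + (f12 f * f23 f - 2 * f22 f * f13 f) * conicZ f x y z).
      by rewrite /conic_det /fX /fY /conicX /conicY /conicZ; ring.
    by rewrite fX0 fY0 -ez; ring.
  - have -> : 2 * conic_det f * y ^+ 2 =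
      y * ((f13 f * f23 f - 2 * f12 f * f33 f) * fX
      + (4 * f11 f * f33 f - f13 f ^+ 2) * fY
      + (f12 f * f13 f - 2 * f11 f * f23 f) * conicZ f x y z).
      by rewrite /conic_det /fX /fY /conicX /conicY /conicZ; ring.
    by rewrite fX0 fY0 -ez; ring.
  - have -> : 2 * conic_det f * z ^+ 2 =
      z * ((f12 f * f23 f - 2 * f22 f * f13 f) * fX
      + (f12 f * f13 f - 2 * f11 f * f23 f) * fY
      + (4 * f11 f * f22 f - f12 f ^+ 2) * conicZ f x y z).
      by rewrite /conic_det /fX /fY /conicX /conicY /conicZ; ring.
    by rewrite fX0 fY0 -ez; ring.
by move/eqP; rewrite mulf_eq0 (negPf d0) pnatr_eq0.
Qed.

(** With [H] the Hessian matrix, [l^T adj(H) l p] equals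
    [l x H (H p x l) + (l . p) adj(H) l] for the cross product [x].  At a point
    of tangency [H p] is proportional to [l] and [l . p = 0]. *)
Lemma conic_line_not_tangent f l :
  tangency f l != 0 -> ~ tangent (conic_poly f) (line_poly l).
Proof.
move=> t0 [p [p0 _ lp rk]]; move/eqP: t0; apply.
have := adapted_minors (gradient_conic p f) (gradient_line p l) rk.
rewrite meval_line in lp.
set x := s1 * p 0 0 + _ + _ in lp *; set y := r1 * p 0 0 + _ + _ in lp *.
set z := p 0 2 in lp *.
move=> [m12 m13 m23].
set A11 := 4 * f22 f * f33 f - f23 f ^+ 2.
set A12 := f13 f * f23 f - 2 * f12 f * f33 f.
set A13 := f12 f * f23 f - 2 * f22 f * f13 f.
set A22 := 4 * f11 f * f33 f - f13 f ^+ 2.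
set A23 := f12 f * f13 f - 2 * f11 f * f23 f.
set A33 := 4 * f11 f * f22 f - f12 f ^+ 2.
set fX := conicX f x y z in m12 m13 m23; set fY := conicY f x y z in m12 m13 m23.
set fZ := conicZ f x y z in m12 m13 m23.
pose u1 := fY * l3 l - fZ * l2 l; pose u2 := - (fX * l3 l - fZ * l1 l).
pose u3 := fX * l2 l - fY * l1 l.
pose v1 := 2 * f11 f * u1 + f12 f * u2 + f13 f * u3.
pose v2 := f12 f * u1 + 2 * f22 f * u2 + f23 f * u3.
pose v3 := f13 f * u1 + f23 f * u2 + 2 * f33 f * u3.
have v10 : v1 = 0 by rewrite /v1 /u1 /u2 /u3 m12 m13 m23; ring.
have v20 : v2 = 0 by rewrite /v2 /u1 /u2 /u3 m12 m13 m23; ring.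
have v30 : v3 = 0 by rewrite /v3 /u1 /u2 /u3 m12 m13 m23; ring.
apply: (annihilated_point p0).
- have -> : tangency f l * x ^+ 2 = x * ((l2 l * v3 - l3 l * v2)
     + line_eq l x y z * (A11 * l1 l + A12 * l2 l + A13 * l3 l)).
    rewrite /tangency /dual_conic /conic_eq /v2 /v3 /u1 /u2 /u3 /fX /fY /fZ.
    rewrite /conicX /conicY /conicZ /line_eq /A11 /A12 /A13 /=; ring.
  by rewrite v20 v30 lp; ring.
- have -> : tangency f l * y ^+ 2 = y * ((l3 l * v1 - l1 l * v3)
     + line_eq l x y z * (A12 * l1 l + A22 * l2 l + A23 * l3 l)).
    rewrite /tangency /dual_conic /conic_eq /v1 /v3 /u1 /u2 /u3 /fX /fY /fZ.
    rewrite /conicX /conicY /conicZ /line_eq /A22 /A12 /A23 /=; ring.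
  by rewrite v10 v30 lp; ring.
- have -> : tangency f l * z ^+ 2 = z * ((l1 l * v2 - l2 l * v1)
     + line_eq l x y z * (A13 * l1 l + A23 * l2 l + A33 * l3 l)).
    rewrite /tangency /dual_conic /conic_eq /v1 /v2 /u1 /u2 /u3 /fX /fY /fZ.
    rewrite /conicX /conicY /conicZ /line_eq /A33 /A13 /A23 /=; ring.
  by rewrite v10 v20 lp; ring.
Qed.

Lemma lines_not_tangent l m : line_cross l m != 0 ->
  [/\ ~ tangent (line_poly l) 'X_2, ~ tangent (line_poly m) 'X_2 &
      ~ tangent (line_poly l) (line_poly m)].
Proof.
rewrite /line_cross -infinity_line_poly => lm0.
split=> -[p [_ _ _ rk]]; move/eqP: lm0; apply.
- have [_ e1 e2] := adapted_minors (gradient_line p l) (gradient_line p _) rk.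
  by move: e1 e2; rewrite /= !mulr1 !mulr0 !subr0 => -> ->; ring.
- have [_ e1 e2] := adapted_minors (gradient_line p m) (gradient_line p _) rk.
  by move: e1 e2; rewrite /= !mulr1 !mulr0 !subr0 => -> ->; ring.
- by have [] := adapted_minors (gradient_line p l) (gradient_line p m) rk.
Qed.

(** The point at infinity of [l] is [(l2, - l1, 0)]. *)
Lemma conic_line_at_infinity f l :
  conic_at_infinity f l != 0 -> ~ meet_at_infinity (conic_poly f) (line_poly l).
Proof.
move=> a0 [p [p0 z0 fp lp]]; move/eqP: a0; apply.
rewrite meval_conic in fp; rewrite meval_line in lp.
have ann := annihilated_point p0.
move: ann fp lp; rewrite z0 !mulr0 !addr0.
set x := s1 * p 0 0 + _; set y := r1 * p 0 0 + _ => ann fp lp.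
apply: ann; last by ring.
- have -> : conic_at_infinity f l * x ^+ 2 = l2 l ^+ 2 * conic_eq f x y 0
     - line_eq l x y 0 * (f12 f * l2 l * x + f22 f * l2 l * y - f22 f * l1 l * x).
    by rewrite /conic_at_infinity /conic_eq /line_eq; ring.
  by rewrite fp lp; ring.
- have -> : conic_at_infinity f l * y ^+ 2 = l1 l ^+ 2 * conic_eq f x y 0
     - line_eq l x y 0 * (f12 f * l1 l * y + f11 f * l1 l * x - f11 f * l2 l * y).
    by rewrite /conic_at_infinity /conic_eq /line_eq; ring.
  by rewrite fp lp; ring.
Qed.

Lemma lines_at_infinity l m :
  line_cross l m != 0 -> ~ meet_at_infinity (line_poly l) (line_poly m).
Proof.
move=> a0 [p [p0 z0 lp mp]]; move/eqP: a0; apply.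
rewrite !meval_line in lp mp.
have ann := annihilated_point p0.
move: ann lp mp; rewrite z0 !mulr0 !addr0.
set x := s1 * p 0 0 + _; set y := r1 * p 0 0 + _ => ann lp mp.
apply: ann; last by ring.
- have -> : line_cross l m * x ^+ 2 =
     x * (l2 m * line_eq l x y 0 - l2 l * line_eq m x y 0).
    by rewrite /line_cross /line_eq; ring.
  by rewrite mp lp; ring.
- have -> : line_cross l m * y ^+ 2 =
     y * (l1 l * line_eq m x y 0 - l1 m * line_eq l x y 0).
    by rewrite /line_cross /line_eq; ring.
  by rewrite mp lp; ring.
Qed.

(** A common point of the two lines is proportional to their cross product. *)
Lemma conic_lines_not_concurrent f l m : conic_at_meet f l m != 0 ->
  ~ concurrent (conic_poly f) (line_poly l) (line_poly m).
Proof.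
move=> a0 [p [p0 fp lp mp]]; move/eqP: a0; apply.
rewrite meval_conic in fp; rewrite !meval_line in lp mp.
have := annihilated_point p0.
set x := s1 * p 0 0 + _ + _ in fp lp mp *; set y := r1 * p 0 0 + _ + _ in fp lp mp *.
set z := p 0 2 in fp lp mp *; apply.
- pose a := l2 l * l3 m - l3 l * l2 m.
  have e2 : x * (l3 l * l1 m - l1 l * l3 m) = a * y.
    apply/eqP; rewrite -subr_eq0; apply/eqP.
    transitivity (l3 l * line_eq m x y z - l3 m * line_eq l x y z).
      by rewrite /line_eq /a; ring.
    by rewrite lp mp; ring.
  have e3 : x * line_cross l m = a * z.
    apply/eqP; rewrite -subr_eq0; apply/eqP.
    transitivity (l2 m * line_eq l x y z - l2 l * line_eq m x y z).
      by rewrite /line_eq /line_cross /a; ring.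
    by rewrite lp mp; ring.
  transitivity (conic_eq f (x * a) (x * (l3 l * l1 m - l1 l * l3 m))
    (x * line_cross l m)).
    by rewrite /conic_at_meet /conic_eq /a; ring.
  rewrite e2 e3; transitivity (a ^+ 2 * conic_eq f x y z).
    by rewrite /conic_eq; ring.
  by rewrite fp mulr0.
- pose b := l3 l * l1 m - l1 l * l3 m.
  have e2 : y * (l2 l * l3 m - l3 l * l2 m) = b * x.
    apply/eqP; rewrite -subr_eq0; apply/eqP.
    transitivity (l3 m * line_eq l x y z - l3 l * line_eq m x y z).
      by rewrite /line_eq /b; ring.
    by rewrite lp mp; ring.
  have e3 : y * line_cross l m = b * z.
    apply/eqP; rewrite -subr_eq0; apply/eqP.
    transitivity (l1 l * line_eq m x y z - l1 m * line_eq l x y z).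
      by rewrite /line_eq /line_cross /b; ring.
    by rewrite lp mp; ring.
  transitivity (conic_eq f (y * (l2 l * l3 m - l3 l * l2 m)) (y * b)
    (y * line_cross l m)).
    by rewrite /conic_at_meet /conic_eq /b; ring.
  rewrite e2 e3; transitivity (b ^+ 2 * conic_eq f x y z).
    by rewrite /conic_eq; ring.
  by rewrite fp mulr0.
- pose c := line_cross l m.
  have e2 : z * (l2 l * l3 m - l3 l * l2 m) = c * x.
    apply/eqP; rewrite -subr_eq0; apply/eqP.
    transitivity (l2 l * line_eq m x y z - l2 m * line_eq l x y z).
      by rewrite /line_eq /c /line_cross; ring.
    by rewrite lp mp; ring.
  have e3 : z * (l3 l * l1 m - l1 l * l3 m) = c * y.
    apply/eqP; rewrite -subr_eq0; apply/eqP.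
    transitivity (l1 m * line_eq l x y z - l1 l * line_eq m x y z).
      by rewrite /line_eq /line_cross /c /line_cross; ring.
    by rewrite lp mp; ring.
  transitivity (conic_eq f (z * (l2 l * l3 m - l3 l * l2 m))
     (z * (l3 l * l1 m - l1 l * l3 m)) (z * c)).
    by rewrite /conic_at_meet /conic_eq /c; ring.
  rewrite e2 e3; transitivity (c ^+ 2 * conic_eq f x y z).
    by rewrite /conic_eq; ring.
  by rewrite fp mulr0.
Qed.

(** A form [F omega' + G dF] has [F = 0] as an integral curve.  Each of the
    three curves of a logarithmic form is covered by this remark. *)
Lemma log_cofactor (w : V3 C) (F G P Q : {mpoly C[3]}) (c : C) : c != 0 ->
  c%:MP * coefP w = F * P + G * F^`M(0) ->
  c%:MP * coefQ w = F * Q + G * F^`M(1) ->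
  Q * F^`M(0) - P * F^`M(1) \is 2.-homog ->
  exists K, Defs.cofactor w F K.
Proof.
move=> c0 eP eQ hK; exists (c^-1 *: (Q * F^`M(0) - P * F^`M(1))).
apply: cofactor_scale => //; rewrite mulrBr !mulrA eP eQ; ring.
Qed.

End AdaptedCoordinates.

(** * Logarithmic forms *)

Section LogForms.
Variable C : numFieldType.
Variables s1 s2 s3 r1 r2 r3 : C.
Hypothesis det0 : s1 * r2 - s2 * r1 != 0.

Lemma line_poly_neq0 l m : line_cross l m != 0 ->
  line_poly s1 s2 s3 r1 r2 r3 l != 0 /\ line_poly s1 s2 s3 r1 r2 r3 m != 0.
Proof.
have aux l' : line_poly s1 s2 s3 r1 r2 r3 l' = 0 -> l1 l' = 0 /\ l2 l' = 0.
  have [d0 d1 _] := mderiv_line_poly s1 s2 s3 r1 r2 r3 l' => l0.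
  move: d0 d1; rewrite l0 !mderiv0 => /esym/eqP; rewrite mpolyC_eq0 => /eqP e0.
  move=> /esym/eqP; rewrite mpolyC_eq0 => /eqP e1.
  split; apply: (mulfI det0); rewrite mulr0.
    have -> : (s1 * r2 - s2 * r1) * l1 l' =
      r2 * (s1 * l1 l' + r1 * l2 l') - r1 * (s2 * l1 l' + r2 * l2 l') by ring.
    by rewrite e0 e1; ring.
  have -> : (s1 * r2 - s2 * r1) * l2 l' =
    s1 * (s2 * l1 l' + r2 * l2 l') - s2 * (s1 * l1 l' + r1 * l2 l') by ring.
  by rewrite e0 e1; ring.
rewrite /line_cross => lm0; split; apply: contra_neq lm0 => /aux [-> ->]; ring.
Qed.

(** The constant [c] clears the denominators of the residues. *)
Lemma log_form_X211 (w : V3 C) f l m (c a0 a1 a2 : C) :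
  let F := conic_poly s1 s2 s3 r1 r2 r3 f in
  let L := line_poly s1 s2 s3 r1 r2 r3 l in let M := line_poly s1 s2 s3 r1 r2 r3 m in
  poincare w -> c != 0 ->
  c%:MP * coefP w = a0%:MP * L * M * F^`M(0) + a1%:MP * F * M * L^`M(0)
    + a2%:MP * F * L * M^`M(0) ->
  c%:MP * coefQ w = a0%:MP * L * M * F^`M(1) + a1%:MP * F * M * L^`M(1)
    + a2%:MP * F * L * M^`M(1) ->
  general_position f l m != 0 -> X_211 w.
Proof.
move=> F L M w0 c0 eP eQ; rewrite /general_position !mulf_eq0 !negb_or.
case/andP=> /andP[/andP[/andP[/andP[det_f tan_z] lm] /andP[tan_l tan_m]]].
case/andP=> [inf_l inf_m] meet.
have Fsm : smooth_curve F by apply: conic_poly_smooth.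
have F0 : F != 0.
  have d0 : delta_mx 0 0 != 0 :> 'rV[C]_3.
    apply/eqP => /matrixP/(_ 0 0); rewrite !mxE eqxx /= => /eqP.
    by rewrite oner_eq0.
  apply/eqP => F0; have := Fsm _ d0; rewrite F0 meval0 => /(_ erefl) /eqP; apply.
  by apply/rowP => i; rewrite !mxE mderiv0 meval0.
have [L0 M0] := line_poly_neq0 lm.
have hF : F \is 2.-homog by apply: conic_poly_homog.
have hL : L \is 1.-homog by apply: line_poly_homog.
have hM : M \is 1.-homog by apply: line_poly_homog.
have [L_x L_y _] := mderiv_line_poly s1 s2 s3 r1 r2 r3 l.
have [M_x M_y _] := mderiv_line_poly s1 s2 s3 r1 r2 r3 m.
rewrite -/L in L_x L_y; rewrite -/M in M_x M_y.
have [F_x F_y _] := mderiv_conic_poly s1 s2 s3 r1 r2 r3 f.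
have hFx : F^`M(0) \is 1.-homog.
  rewrite F_x /conicX /conicY /= -mpolyC_nat -!mpolyCM.
  have := affine_lin_homog s1 s2 s3; have := affine_lin_homog r1 r2 r3 => hS hR.
  solve_homog.
have hFy : F^`M(1) \is 1.-homog.
  rewrite F_y /conicX /conicY /= -mpolyC_nat -!mpolyCM.
  have := affine_lin_homog s1 s2 s3; have := affine_lin_homog r1 r2 r3 => hS hR.
  solve_homog.
clear F_x F_y.
split=> //; exists F, L, M; split; split.
- split; first by split.
  apply: (@log_cofactor _ _ F (a0%:MP * L * M)
     (a1%:MP * M * L^`M(0) + a2%:MP * L * M^`M(0))
     (a1%:MP * M * L^`M(1) + a2%:MP * L * M^`M(1)) c) => //.
  + by rewrite eP; ring.
  + by rewrite eQ; ring.
  + rewrite L_x L_y M_x M_y; solve_homog.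
- by [].
- split; first by split.
  apply: (@log_cofactor _ _ L (a1%:MP * F * M)
     (a0%:MP * M * F^`M(0) + a2%:MP * F * M^`M(0))
     (a0%:MP * M * F^`M(1) + a2%:MP * F * M^`M(1)) c) => //.
  + by rewrite eP; ring.
  + by rewrite eQ; ring.
  + rewrite L_x L_y M_x M_y; solve_homog.
- split; first by split.
  apply: (@log_cofactor _ _ M (a2%:MP * F * L)
     (a0%:MP * L * F^`M(0) + a1%:MP * F * L^`M(0))
     (a0%:MP * L * F^`M(1) + a1%:MP * F * L^`M(1)) c) => //.
  + by rewrite eP; ring.
  + by rewrite eQ; ring.
  + rewrite L_x L_y M_x M_y; solve_homog.
- have [nL nM nLM] := lines_not_tangent s3 r3 det0 lm.
  rewrite -(infinity_line_poly s1 s2 s3 r1 r2 r3) in nL nM *.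
  by split; [exact: conic_line_not_tangent | exact: nL | exact: nM].
- have [nL nM nLM] := lines_not_tangent s3 r3 det0 lm.
  by split; [exact: conic_line_not_tangent | exact: conic_line_not_tangent
            | exact: nLM].
- by split; [exact: conic_line_at_infinity | exact: conic_line_at_infinity |
   exact: lines_at_infinity].
- exact: conic_lines_not_concurrent.
Qed.
End LogForms.

(** * Poincare forms of the family *)

Section Partials.
Variable K : comNzRingType.
Implicit Types (th : params K) (X Y Z : K).

Definition crMX th X Y : K := (pn th - pp th) * Y - 2 * pq th * X.
Definition crMY th X Y : K := (pn th - pp th) * X + 2 * pm th * Y.
Definition crAX th X Y Z : K :=
  pl th * Y * Z + pq th * crT th X Y Z + crU th X Y * crTX th X Y Z
  + crMX th X Y * crTX th X Y Z + 2 * pa th * crM th X Y.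
Definition crAY th X Y Z : K :=
  (crW th X Y + pk th * Y) * Z + pp th * crT th X Y Z
  + crU th X Y * crTY th X Y Z + crMY th X Y * crTX th X Y Z
  + pb th * crM th X Y.
Definition crBX th X Y Z : K :=
  - (crW th X Y + pl th * X) * Z - pn th * crT th X Y Z
  - crV th X Y * crTX th X Y Z + crMX th X Y * crTY th X Y Z
  + pb th * crM th X Y.
Definition crBY th X Y Z : K :=
  - (pk th * X * Z) - pm th * crT th X Y Z - crV th X Y * crTY th X Y Z
  + crMY th X Y * crTY th X Y Z + 2 * pc th * crM th X Y.

Definition crF_conic th : conic K :=
  {| f11 := crD th * pa th; f12 := crD th * pb th; f22 := crD th * pc th;
     f13 := crD th * pd th + (pk th * pq th - pl th * pp th);
     f23 := crD th * pe th - (pk th * pn th - pl th * pm th);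
     f33 := crD th * pt th |}.
End Partials.

Section PartialsMorphism.
Variables (K L : comNzRingType) (f : {rmorphism K -> L}).

Lemma rmorph_cr_partials th X Y Z :
  let th' := map_params f th in
  [/\ f (crAX th X Y Z) = crAX th' (f X) (f Y) (f Z),
      f (crAY th X Y Z) = crAY th' (f X) (f Y) (f Z),
      f (crBX th X Y Z) = crBX th' (f X) (f Y) (f Z) &
      f (crBY th X Y Z) = crBY th' (f X) (f Y) (f Z)].
Proof.
rewrite /crAX /crAY /crBX /crBY /crMX /crMY.
by rewrite /crM /crU /crV /crW /crT /crTX /crTY /=; split; ring.
Qed.
End PartialsMorphism.

Section CenteredForms.
Variable C : numFieldType.
Implicit Types th : params C.

Lemma mderiv_cr th (X Y Z : {mpoly C[3]}) i : Z^`M(i) = 0 ->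
  (crA (cstp 3 th) X Y Z)^`M(i) =
    crAX (cstp 3 th) X Y Z * X^`M(i) + crAY (cstp 3 th) X Y Z * Y^`M(i) /\
  (crB (cstp 3 th) X Y Z)^`M(i) =
    crBX (cstp 3 th) X Y Z * X^`M(i) + crBY (cstp 3 th) X Y Z * Y^`M(i).
Proof.
move=> Zi; rewrite /crA /crB /crAX /crAY /crBX /crBY /crMX /crMY.
rewrite /crM /crU /crV /crW /crT /crTX /crTY /= !expr2.
split; rewrite -mpolyC_nat !(mderivD, mderivN, mderivM, mderivC) Zi; ring.
Qed.

Lemma meval_cr th (X Y Z : {mpoly C[3]}) v :
  let x := X.@[v] in let y := Y.@[v] in let z := Z.@[v] in
  [/\ (crAX (cstp 3 th) X Y Z).@[v] = crAX th x y z,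
      (crAY (cstp 3 th) X Y Z).@[v] = crAY th x y z,
      (crBX (cstp 3 th) X Y Z).@[v] = crBX th x y z &
      (crBY (cstp 3 th) X Y Z).@[v] = crBY th x y z] /\
  (crA (cstp 3 th) X Y Z).@[v] = crA th x y z /\
  (crB (cstp 3 th) X Y Z).@[v] = crB th x y z.
Proof.
have thE : map_params (meval v) (cstp 3 th) = th.
  by case: th => *; rewrite /map_params /= !mevalC.
have := rmorph_cr_partials (meval v) (cstp 3 th) X Y Z.
have := rmorph_crA (meval v) (cstp 3 th) X Y Z.
have := rmorph_crB (meval v) (cstp 3 th) X Y Z.
by rewrite /= thE.
Qed.

(** Write the form as [A dS + B dR].  With [J] the Jacobian matrix of [(A, B)]
    and [Q] the matrix of the coordinate change, the Poincare condition is
    [Q^T J Q = 1]; it is solved here for [J]. *)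
Lemma poincare_adapted (w : V3 C) (A B : {mpoly C[3]}) (s1 s2 r1 r2 : C)
    (a b ax ay bx by_ : C) :
  let o : 'rV[C]_3 := delta_mx 0 2 in
  let det2 := (s1 * r2 - s2 * r1) ^+ 2 in
  s1 * r2 - s2 * r1 != 0 ->
  coefP w = s1%:MP * A + r1%:MP * B -> coefQ w = s2%:MP * A + r2%:MP * B ->
  A.@[o 0] = a -> B.@[o 0] = b ->
  A^`M(0).@[o 0] = s1 * ax + r1 * ay -> A^`M(1).@[o 0] = s2 * ax + r2 * ay ->
  B^`M(0).@[o 0] = s1 * bx + r1 * by_ -> B^`M(1).@[o 0] = s2 * bx + r2 * by_ ->
  poincare w <->
  [/\ a = 0 /\ b = 0, det2 * ax = r1 ^+ 2 + r2 ^+ 2,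
      det2 * ay = - (s1 * r1 + s2 * r2), det2 * bx = - (s1 * r1 + s2 * r2) &
      det2 * by_ = s1 ^+ 2 + s2 ^+ 2].
Proof.
move=> o det2 det0 eP eQ Ao Bo A_x A_y B_x B_y.
have e2 (u v : C) (U V : {mpoly C[3]}) :
    (u%:MP * U + v%:MP * V).@[o 0] = u * U.@[o 0] + v * V.@[o 0].
  by meval_simpl.
have d2 i (u v : C) (U V : {mpoly C[3]}) :
    (u%:MP * U + v%:MP * V)^`M(i) = u%:MP * U^`M(i) + v%:MP * V^`M(i).
  by rewrite mderivD !mderiv_mulC.
rewrite /poincare -/o eP eQ !d2 !e2 Ao Bo A_x A_y B_x B_y.
split.
- case=> [[P0 Q0]] [Px Qy] [Py Qx].
  (* in the sums below each 0 or 1 of a product stands for the left-hand side of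
     one of the four equations on the derivatives *)
  split; first split.
  + apply: (mulfI det0); rewrite mulr0.
    transitivity (r2 * (s1 * a + r1 * b) - r1 * (s2 * a + r2 * b)); first ring.
    by rewrite P0 Q0; ring.
  + apply: (mulfI det0); rewrite mulr0.
    transitivity (s1 * (s2 * a + r2 * b) - s2 * (s1 * a + r1 * b)); first ring.
    by rewrite P0 Q0; ring.
  + transitivity (r2 ^+ 2 * 1 - r1 * r2 * 0 - r1 * r2 * 0 + r1 ^+ 2 * 1 : C);
      last by ring.
    by rewrite -{1}Px -{1}Py -{1}Qx -{1}Qy; rewrite /det2; ring.
  + transitivity (- r2 * s2 * 1 + s1 * r2 * 0 + r1 * s2 * 0 - s1 * r1 * 1 : C);
      last by ring.
    by rewrite -{1}Px -{1}Py -{1}Qx -{1}Qy; rewrite /det2; ring.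
  + transitivity (- r2 * s2 * 1 + s1 * r2 * 0 + r1 * s2 * 0 - s1 * r1 * 1 : C);
      last by ring.
    by rewrite -{1}Px -{1}Qx -{1}Py -{1}Qy; rewrite /det2; ring.
  + transitivity (s2 ^+ 2 * 1 - s1 * s2 * 0 - s1 * s2 * 0 + s1 ^+ 2 * 1 : C);
      last by ring.
    by rewrite -{1}Px -{1}Py -{1}Qx -{1}Qy; rewrite /det2; ring.
- have det20 : det2 != 0 by rewrite expf_neq0.
  case=> [[A0 B0]] eAX eAY eBX eBY; rewrite A0 B0.
  split; split; try ring; apply: (mulfI det20).
  + transitivity (s1 ^+ 2 * (det2 * ax) + s1 * r1 * (det2 * ay)
      + s1 * r1 * (det2 * bx) + r1 ^+ 2 * (det2 * by_)); first ring.
    by rewrite eAX eAY eBX eBY /det2; ring.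
  + transitivity (s2 ^+ 2 * (det2 * ax) + s2 * r2 * (det2 * ay)
      + s2 * r2 * (det2 * bx) + r2 ^+ 2 * (det2 * by_)); first ring.
    by rewrite eAX eAY eBX eBY /det2; ring.
  + transitivity (s1 * s2 * (det2 * ax) + s1 * r2 * (det2 * ay)
      + s2 * r1 * (det2 * bx) + r1 * r2 * (det2 * by_)); first ring.
    by rewrite eAX eAY eBX eBY /det2; ring.
  + transitivity (s1 * s2 * (det2 * ax) + s2 * r1 * (det2 * ay)
      + s1 * r2 * (det2 * bx) + r1 * r2 * (det2 * by_)); first ring.
    by rewrite eAX eAY eBX eBY /det2; ring.
Qed.

Variables s1 s2 s3 r1 r2 r3 : C.
Hypothesis det0 : s1 * r2 - s2 * r1 != 0.
Let X := affine_lin s1 s2 s3.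
Let Y := affine_lin r1 r2 r3.

(** The retraction [insubd] keeps the definition free of homogeneity proofs;
    [cr_formE] shows that it does nothing. *)
Definition cr_form th : V3 C :=
  let A := crA (cstp 3 th) X Y 'X_2 in let B := crB (cstp 3 th) X Y 'X_2 in
  (insubd (0 : dhomog 3 C 3) (s1%:MP * A + r1%:MP * B),
   insubd (0 : dhomog 3 C 3) (s2%:MP * A + r2%:MP * B)).

Lemma cr_formE th :
  let A := crA (cstp 3 th) X Y 'X_2 in let B := crB (cstp 3 th) X Y 'X_2 in
  coefP (cr_form th) = s1%:MP * A + r1%:MP * B /\
  coefQ (cr_form th) = s2%:MP * A + r2%:MP * B.
Proof.
move=> A B.
have hX : X \is 1.-homog by apply: affine_lin_homog.
have hY : Y \is 1.-homog by apply: affine_lin_homog.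
have hA : A \is 3.-homog by apply: crA_homog => //; apply: dhomogX1.
have hB : B \is 3.-homog by apply: crB_homog => //; apply: dhomogX1.
have hAB (u v : C) : u%:MP * A + v%:MP * B \is 3.-homog by solve_homog.
by split; rewrite /coefP /coefQ /cr_form /= -[LHS]/(val _) val_insubd;
  rewrite ifT //; apply: hAB.
Qed.

Lemma cr_form_eq (w : V3 C) th :
  coefP w = coefP (cr_form th) -> coefQ w = coefQ (cr_form th) ->
  w = cr_form th.
Proof.
case: w => P Q eP eQ; rewrite [RHS]surjective_pairing.
by congr pair; apply: val_inj.
Qed.

Lemma poincare_cr_form th :
  let det2 := (s1 * r2 - s2 * r1) ^+ 2 in
  poincare (cr_form th) <->
  [/\ crA th s3 r3 1 = 0 /\ crB th s3 r3 1 = 0,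
      det2 * crAX th s3 r3 1 = r1 ^+ 2 + r2 ^+ 2,
      det2 * crAY th s3 r3 1 = - (s1 * r1 + s2 * r2),
      det2 * crBX th s3 r3 1 = - (s1 * r1 + s2 * r2) &
      det2 * crBY th s3 r3 1 = s1 ^+ 2 + s2 ^+ 2].
Proof.
move=> det2.
pose o : 'rV[C]_3 := delta_mx 0 2.
have oE i : o 0 i = (i == 2)%:R by rewrite !mxE.
have Xo : X.@[o 0] = s3.
  by rewrite /X /affine_lin; meval_simpl; rewrite !oE /= !mulr0 !add0r mulr1.
have Yo : Y.@[o 0] = r3.
  by rewrite /Y /affine_lin; meval_simpl; rewrite !oE /= !mulr0 !add0r mulr1.
have Zo : ('X_2 : {mpoly C[3]}).@[o 0] = 1 by rewrite mevalXU oE.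
have [[AXo AYo BXo BYo] [Ao Bo]] := meval_cr th X Y 'X_2 (o 0).
rewrite Xo Yo Zo in Ao Bo AXo AYo BXo BYo.
have [X_x X_y _] := mderiv_affine_lin s1 s2 s3.
have [Y_x Y_y _] := mderiv_affine_lin r1 r2 r3.
have Z_x : ('X_2 : {mpoly C[3]})^`M(0) = 0 by rewrite mderivXU.
have Z_y : ('X_2 : {mpoly C[3]})^`M(1) = 0 by rewrite mderivXU.
have [A_x B_x] := mderiv_cr th X Y Z_x; have [A_y B_y] := mderiv_cr th X Y Z_y.
rewrite X_x Y_x in A_x B_x; rewrite X_y Y_y in A_y B_y.
have e2 (u v : C) (U V : {mpoly C[3]}) :
    (U * u%:MP + V * v%:MP).@[o 0] = u * U.@[o 0] + v * V.@[o 0].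
  by meval_simpl; rewrite mulrC [V.@[_] * _]mulrC.
have [eP eQ] := cr_formE th.
apply: (poincare_adapted det0 eP eQ Ao Bo).
- exact: etrans (etrans (congr1 (meval (o 0)) A_x) (e2 s1 r1 _ _))
    (congr2 (fun u v => s1 * u + r1 * v) AXo AYo).
- exact: etrans (etrans (congr1 (meval (o 0)) A_y) (e2 s2 r2 _ _))
    (congr2 (fun u v => s2 * u + r2 * v) AXo AYo).
- exact: etrans (etrans (congr1 (meval (o 0)) B_x) (e2 s1 r1 _ _))
    (congr2 (fun u v => s1 * u + r1 * v) BXo BYo).
- exact: etrans (etrans (congr1 (meval (o 0)) B_y) (e2 s2 r2 _ _))
    (congr2 (fun u v => s2 * u + r2 * v) BXo BYo).
Qed.

(** The hypotheses on [q], [m], [n] say that [M] is the product of the two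
    lines.  Then [U dX - V dY] is a combination of [L2 dL1] and [L1 dL2], with
    coefficients [(p + l2 m1) / delta] and [- (p + l1 m2) / delta]. *)
Lemma cr_form_X211 th l m :
  let delta := line_cross l m in
  l3 l = 0 -> l3 m = 0 ->
  pq th = - (l1 l * l1 m) -> pm th = l2 l * l2 m ->
  pn th = pp th + (l1 l * l2 m + l2 l * l1 m) ->
  poincare (cr_form th) -> crD th != 0 ->
  general_position (crF_conic th) l m != 0 -> X_211 (cr_form th).
Proof.
move=> delta l30 m30 eq em en hw D0 gp.
have delta0 : delta != 0.
  apply: contraNneq gp; rewrite /general_position /delta => ->.
  by rewrite mulr0 !mul0r.
have [eP eQ] := cr_formE th.
pose A := crA (cstp 3 th) X Y 'X_2; pose B := crB (cstp 3 th) X Y 'X_2.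
have [F_x F_y _] := mderiv_conic_poly s1 s2 s3 r1 r2 r3 (crF_conic th).
have [L_x L_y _] := mderiv_line_poly s1 s2 s3 r1 r2 r3 l.
have [M_x M_y _] := mderiv_line_poly s1 s2 s3 r1 r2 r3 m.
rewrite -/X -/Y in eP eQ F_x F_y.
set F := conic_poly _ _ _ _ _ _ _ in F_x F_y.
set L := line_poly _ _ _ _ _ _ _ in L_x L_y.
set M := line_poly _ _ _ _ _ _ _ in M_x M_y.
have FE : crF (cstp 3 th) X Y 'X_2 = F.
  by rewrite /F /conic_poly -/X -/Y /conic_eq /crF /crT /= /crD /=; ring.
have FXE : crFX (cstp 3 th) X Y 'X_2 = conicX (cst_conic (crF_conic th)) X Y 'X_2.
  by rewrite /crFX /crTX /conicX /= /crD /=; ring.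
have FYE : crFY (cstp 3 th) X Y 'X_2 = conicY (cst_conic (crF_conic th)) X Y 'X_2.
  by rewrite /crFY /crTY /conicY /= /crD /=; ring.
have ME : crM (cstp 3 th) X Y = L * M.
  rewrite /L /M /line_poly -/X -/Y /line_eq /crM /crU /crV /= eq en em l30 m30; ring.
have key (u v : C) : delta%:MP *
   (u%:MP * crU (cstp 3 th) X Y - v%:MP * crV (cstp 3 th) X Y) =
   (pp th + l2 l * l1 m)%:MP * M * (u * l1 l + v * l2 l)%:MP
   + (- (pp th + l1 l * l2 m))%:MP * L * (u * l1 m + v * l2 m)%:MP.
  rewrite /L /M /line_poly -/X -/Y /line_eq /crU /crV /= eq en em l30 m30.
  by rewrite /delta /line_cross; ring.
have factor (u v : C) : (delta * crD th)%:MP * (u%:MP * A + v%:MP * B) =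
    F * (delta%:MP * (u%:MP * crU (cstp 3 th) X Y - v%:MP * crV (cstp 3 th) X Y))
    + delta%:MP * L * M *
      (u%:MP * conicX (cst_conic (crF_conic th)) X Y 'X_2
       + v%:MP * conicY (cst_conic (crF_conic th)) X Y 'X_2).
  have eA := crA_factor (cstp 3 th) X Y 'X_2.
  have eB := crB_factor (cstp 3 th) X Y 'X_2.
  rewrite -/A crD_cst FE FXE ME in eA; rewrite -/B crD_cst FE FYE ME in eB.
  rewrite mpolyCM; transitivity (delta%:MP *
    (u%:MP * ((crD th)%:MP * A) + v%:MP * ((crD th)%:MP * B))); first by ring.
  by rewrite eA eB; ring.
apply: (@log_form_X211 C s1 s2 s3 r1 r2 r3 det0 (cr_form th) (crF_conic th) l m
  (delta * crD th) delta (pp th + l2 l * l1 m) (- (pp th + l1 l * l2 m))) => //.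
- by rewrite mulf_neq0.
- rewrite -/F -/L -/M F_x L_x M_x eP -/A -/B factor key; ring.
- rewrite -/F -/L -/M F_y L_y M_y eQ -/A -/B factor key; ring.
Qed.
End CenteredForms.

(** * Every form of the family in adapted coordinates *)

Section NormalForm.
Variable C : numFieldType.

Lemma cstp_linear_change (th : params C) a11 a12 a21 a22 :
  cstp 3 (params_linear_change th a11 a12 a21 a22) =
  params_linear_change (cstp 3 th) a11%:MP a12%:MP a21%:MP a22%:MP.
Proof.
case: th => *; rewrite /cstp /map_params /params_linear_change /=.
congr Params; ring.
Qed.

(** The family is stable under linear substitutions, so an affine change of
    coordinates only remembers the common point [c] of the two lines, and the
    linear coordinates may then be chosen according to [c]. *)
Lemma Y_CR16_cr_form (w : V3 C) : Y_CR16 w ->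
  exists c1 c2 : C, forall s1 s2 r1 r2 : C, s1 * r2 - s2 * r1 != 0 ->
  exists th : params C, pt th = 1 /\
    w = cr_form s1 s2 (- (s1 * c1 + s2 * c2)) r1 r2 (- (r1 * c1 + r2 * c2)) th.
Proof.
case=> a [b [c [d [e [k [l [m [n [p [q [A [t [A_unit wE]]]]]]]]]]]]].
have AV := mulmxV A_unit.
(* [v] is the preimage of the origin by the affine map *)
have [v Av] : exists v : 'cV[C]_2, A *m v = - t^T.
  by exists (- (invmx A *m t^T)); rewrite mulmxN mulmxA AV mul1mx.
have tE i : t 0 i = - (A i 0 * v 0 0 + A i 1 * v 1 0).
  have := congr1 (fun B : 'cV_2 => B i 0) Av.
  rewrite !mxE !big_ord_recl big_ord0 addr0.
  have -> : lift ord0 ord0 = 1 :> 'I_2 by apply: val_inj.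
  by move=> Avi; apply: oppr_inj; rewrite opprK; apply: esym Avi.
exists (v 0 0), (v 1 0) => s1 s2 r1 r2 det0.
set det := s1 * r2 - s2 * r1 in det0.
(* the row [(al i, be i)] expresses row [i] of [A] in the new coordinates *)
pose al i := (A i 0 * r2 - A i 1 * r1) / det.
pose be i := (A i 1 * s1 - A i 0 * s2) / det.
have A0 i : A i 0 = al i * s1 + be i * r1.
  by rewrite /al /be /det; field.
have A1 i : A i 1 = al i * s2 + be i * r2.
  by rewrite /al /be /det; field.
exists (params_linear_change (Params a b c d e 1 k l m n p q)
  (al 0) (be 0) (al 1) (be 1)); split=> //.
set x0 := s1 * v 0 0 + _; set y0 := r1 * v 0 0 + _.
have XE i : affine_lin (A i 0) (A i 1) (t 0 i) =
    (al i)%:MP * affine_lin s1 s2 (- x0) + (be i)%:MP * affine_lin r1 r2 (- y0).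
  by rewrite tE /affine_lin /x0 /y0 !A0 !A1; ring.
have [eA eB] := cr_linear_change (cstp 3 (Params a b c d e 1 k l m n p q))
  (affine_lin s1 s2 (- x0)) (affine_lin r1 r2 (- y0)) 'X_2
  (al 0)%:MP (be 0)%:MP (al 1)%:MP (be 1)%:MP.
rewrite -cstp_linear_change in eA eB.
have [cP cQ] := cr_formE s1 s2 (- x0) r1 r2 (- y0)
  (params_linear_change (Params a b c d e 1 k l m n p q)
  (al 0) (be 0) (al 1) (be 1)).
apply: cr_form_eq; rewrite ?cP ?cQ {cP cQ} wE.
- rewrite -[LHS]/(homogenize 3 _) homogenize_pullback -eA -eB !XE !A0.
  ring.
- rewrite -[LHS]/(homogenize 3 _) homogenize_pullback -eA -eB !XE !A1.
  ring.
Qed.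
End NormalForm.

(** * Families of Poincare forms *)

Ltac solve_polyfun :=
  lazymatch goal with
  | |- polyfun (fun s => s) => exact: polyfun_id
  | |- polyfun (fun s => @?f s + @?g s) =>
      apply: (@polyfunD _ f g); solve_polyfun
  | |- polyfun (fun s => - @?f s) =>
      apply: (@polyfunN _ f); solve_polyfun
  | |- polyfun (fun s => @?f s * @?g s) =>
      apply: (@polyfunM _ f g); solve_polyfun
  | |- polyfun (fun s => @?f s ^+ ?n) =>
      apply: (@polyfunX _ f n); solve_polyfun
  | |- _ => first [assumption | exact: polyfun_interp | exact: polyfun_cst]
  end.

Ltac solve_polyfamily :=
  lazymatch goal with
  | |- polyfamily (fun s => (@?f s)%:MP) => apply: (@polyfamilyC _ _ f); assumption
  | |- polyfamily (fun s => @?f s + @?g s) =>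
      apply: (@polyfamilyD _ _ f g); solve_polyfamily
  | |- polyfamily (fun s => - @?f s) => apply: (@polyfamilyN _ _ f); solve_polyfamily
  | |- polyfamily (fun s => @?f s * @?g s) =>
      apply: (@polyfamilyM _ _ f g); solve_polyfamily
  | |- _ => exact: polyfamily_cst
  end.

Section Families.
Variable C : numFieldType.

Definition polyparams (th : C -> params C) : Prop :=
  [/\ [/\ polyfun (fun s => pa (th s)), polyfun (fun s => pb (th s)),
          polyfun (fun s => pc (th s)), polyfun (fun s => pd (th s))
        & polyfun (fun s => pe (th s))],
      [/\ polyfun (fun s => pt (th s)), polyfun (fun s => pk (th s))
        & polyfun (fun s => pl (th s))]
    & [/\ polyfun (fun s => pm (th s)), polyfun (fun s => pn (th s)),
          polyfun (fun s => pp (th s)) & polyfun (fun s => pq (th s))]].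

Definition polyline (l : C -> line C) : Prop :=
  [/\ polyfun (fun s => l1 (l s)), polyfun (fun s => l2 (l s))
    & polyfun (fun s => l3 (l s))].

Lemma polyfamily_cr (X Y Z : {mpoly C[3]}) (th : C -> params C) :
  polyparams th ->
  polyfamily (fun s => crA (cstp 3 (th s)) X Y Z) /\
  polyfamily (fun s => crB (cstp 3 (th s)) X Y Z).
Proof.
case=> [[ha hb hc hd he] [ht hk hl] [hm hn hp hq]].
rewrite /crA /crB /crM /crU /crV /crW /crT /crTX /crTY /=.
by split; solve_polyfamily.
Qed.

Lemma polyfun_general_position th l m :
  polyparams th -> polyline l -> polyline m ->
  polyfun (fun s => general_position (crF_conic (th s)) (l s) (m s)).
Proof.
case=> [[ha hb hc hd he] [ht hk hl] [hm hn hp hq]] [hl1 hl2 hl3] [hm1 hm2 hm3].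
rewrite /general_position /tangency /conic_at_infinity /conic_at_meet.
rewrite /conic_det /conic_eq /dual_conic /line_cross /crF_conic /crD /=.
solve_polyfun.
Qed.

Variables s1 s2 s3 r1 r2 r3 : C.
Hypothesis det0 : s1 * r2 - s2 * r1 != 0.

(** The value at [s = 1] is only there to show that general position holds for
    almost all [s]. *)
Lemma closure_cr_family (th : C -> params C) (l m : C -> line C) :
  polyparams th -> polyline l -> polyline m ->
  (forall s, l3 (l s) = 0 /\ l3 (m s) = 0) ->
  (forall s, [/\ pq (th s) = - (l1 (l s) * l1 (m s)),
                 pm (th s) = l2 (l s) * l2 (m s) &
     pn (th s) = pp (th s) + (l1 (l s) * l2 (m s) + l2 (l s) * l1 (m s))]) ->
  (forall s, poincare (cr_form s1 s2 s3 r1 r2 r3 (th s))) ->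
  crD (th 1) != 0 ->
  general_position (crF_conic (th 1)) (l 1) (m 1) != 0 ->
  zariski_closure (@X_211 C) (cr_form s1 s2 s3 r1 r2 r3 (th 0)).
Proof.
move=> hth hl hm lm0 split_th hw D1 gp1.
have [hA hB] := polyfamily_cr (affine_lin s1 s2 s3) (affine_lin r1 r2 r3) 'X_2 hth.
have aux (u v : C) : polyfamily (fun s =>
    u%:MP * crA (cstp 3 (th s)) (affine_lin s1 s2 s3) (affine_lin r1 r2 r3) 'X_2 +
    v%:MP * crB (cstp 3 (th s)) (affine_lin s1 s2 s3) (affine_lin r1 r2 r3) 'X_2).
  by apply: polyfamilyD; apply: polyfamilyM => //; apply: polyfamily_cst.
apply: (@closure_of_polynomial_curve _ _ (fun s => cr_form s1 s2 s3 r1 r2 r3 (th s))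
  (fun s => crD (th s) * general_position (crF_conic (th s)) (l s) (m s)) 1).
- move=> k; apply: (polyfun_ext _ (aux s1 r1 k)) => s.
  by have [-> _] := cr_formE s1 s2 s3 r1 r2 r3 (th s).
- move=> k; apply: (polyfun_ext _ (aux s2 r2 k)) => s.
  by have [_ ->] := cr_formE s1 s2 s3 r1 r2 r3 (th s).
- apply: polyfunM; last exact: polyfun_general_position.
  case: hth => [_ _ [? ? ? ?]]; rewrite /crD; solve_polyfun.
- by rewrite mulf_neq0.
- move=> s; rewrite mulf_eq0 negb_or => /andP[D0 gp].
  have [l0 m0] := lm0 s; have [eq em en] := split_th s.
  exact: (@cr_form_X211 _ _ _ _ _ _ _ det0 _ (l s) (m s)).
Qed.
End Families.

(** * The three positions of the centre *)

Section Cases.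
Variable C : numClosedFieldType.

Ltac unfold_cr := rewrite /crA /crB /crAX /crAY /crBX /crBY /crMX /crMY
  /crM /crU /crV /crW /crT /crTX /crTY /=.

Ltac unfold_gp := rewrite /general_position /tangency /conic_at_infinity
  /conic_at_meet /conic_det /conic_eq /dual_conic /line_cross /crF_conic /crD /=.

(** If the centre is the origin, the linear part of the form is [U dX - V dY].
    It is determined by the Poincare condition, while [T] and [W] are free; the
    two lines are the isotropic lines.  The example at [s = 1] is
    [T = X ^ 2 + Y ^ 2 + 1], [W = 0]. *)
Lemma closure_center_origin s1 s2 r1 r2 th :
  let det := s1 * r2 - s2 * r1 in
  det != 0 -> r1 ^+ 2 + r2 ^+ 2 = 0 -> s1 ^+ 2 + s2 ^+ 2 = 0 ->
  s1 * r1 + s2 * r2 = 1 ->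
  pt th = 1 -> poincare (cr_form s1 s2 0 r1 r2 0 th) ->
  zariski_closure (@X_211 C) (cr_form s1 s2 0 r1 r2 0 th).
Proof.
move=> det det0 rr ss sr; case: th => a b c d e t k l m n p q /= -> {t}.
have det2 : det ^+ 2 = -1.
  transitivity ((s1 ^+ 2 + s2 ^+ 2) * (r1 ^+ 2 + r2 ^+ 2)
    - (s1 * r1 + s2 * r2) ^+ 2); first by rewrite /det; ring.
  by rewrite rr ss sr; ring.
move/(poincare_cr_form 0 0 det0); rewrite -/det det2 rr ss sr => -[_].
unfold_cr => eAX eAY eBX eBY.
have q0 : q = 0 by apply: oppr_inj; rewrite oppr0 -[RHS]eAX; ring.
have p1 : p = 1 by apply: oppr_inj; rewrite -eAY; ring.
have n1 : n = -1 by rewrite -eBX; ring.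
have m0 : m = 0 by rewrite -[RHS]eBY; ring.
rewrite {eAX eAY eBX eBY}q0 p1 n1 m0.
pose fam s := Params (interp a 1 s) (interp b 0 s) (interp c 1 s) (interp d 0 s)
  (interp e 0 s) 1 (interp k 0 s) (interp l 0 s) 0 (-1) 1 0 : params C.
have -> : Params a b c d e 1 k l 0 (-1) 1 0 = fam 0 by rewrite /fam !interp0.
apply: (@closure_cr_family C s1 s2 0 r1 r2 0 det0 fam (fun=> Line 1 0 0)
  (fun=> Line 0 (-2) 0)).
- by split; split; rewrite /=; solve_polyfun.
- by split; rewrite /=; solve_polyfun.
- by split; rewrite /=; solve_polyfun.
- by [].
- by move=> s; split=> /=; ring.
- move=> s; apply/(poincare_cr_form 0 0 det0); rewrite -/det det2 rr ss sr /fam.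
  by unfold_cr; split; first split; ring.
- by rewrite /crD /=; rewrite (_ : _ - _ = 1) ?oner_neq0 //; ring.
- have -> : crF_conic (fam 1) = Conic 1 0 1 0 0 1.
    by rewrite /fam !interp1 /crF_conic /crD /=; congr Conic; ring.
  unfold_gp.
  (* the factors of [general_position], in order *)
  set g := (X in X != 0); rewrite (_ : g = - (4 * 4 * 2 * (4 * 16) * 4 * 4)).
    by rewrite oppr_eq0 !mulf_neq0 ?pnatr_eq0.
  by rewrite /g; ring.
Qed.

(** [W] is kept, while the scaling of [T] and that of [U], [V], [M] cancel. *)
Lemma cr_rescale (K : comNzRingType) (u v : K) th X Y Z : u * v = 1 ->
  let th' := Params (u * pa th) (u * pb th) (u * pc th) (u * pd th) (u * pe th)
    (u * pt th) (pk th) (pl th) (v * pm th) (v * pn th) (v * pp th) (v * pq th) in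
  crA th' X Y Z = crA th X Y Z /\ crB th' X Y Z = crB th X Y Z.
Proof.
move=> uv th'; have T' : crT th' X Y Z = u * crT th X Y Z by rewrite /crT /=; ring.
have TX' : crTX th' X Y Z = u * crTX th X Y Z by rewrite /crTX /=; ring.
have TY' : crTY th' X Y Z = u * crTY th X Y Z by rewrite /crTY /=; ring.
have U' : crU th' X Y = v * crU th X Y by rewrite /crU /=; ring.
have V' : crV th' X Y = v * crV th X Y by rewrite /crV /=; ring.
have M' : crM th' X Y = v * crM th X Y by rewrite /crM U' V'; ring.
rewrite /crA /crB T' TX' TY' U' V' M'; split.
- rewrite -[crU th X Y in RHS]mul1r -[crM th X Y in RHS]mul1r -uv.
  by rewrite /crW /=; ring.
- rewrite -[crV th X Y in RHS]mul1r -[crM th X Y in RHS]mul1r -uv.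
  by rewrite /crW /=; ring.
Qed.

Lemma cr_form_rescale s1 s2 s3 r1 r2 r3 (u : C) th : u != 0 ->
  cr_form s1 s2 s3 r1 r2 r3 th = cr_form s1 s2 s3 r1 r2 r3
   (Params (u * pa th) (u * pb th) (u * pc th) (u * pd th) (u * pe th)
    (u * pt th) (pk th) (pl th) (u^-1 * pm th) (u^-1 * pn th) (u^-1 * pp th)
    (u^-1 * pq th)).
Proof.
move=> u0; set th' := Params _ _ _ _ _ _ _ _ _ _ _ _.
have uv : (u%:MP : {mpoly C[3]}) * (u^-1)%:MP = 1.
  by rewrite -mpolyCM mulfV // mpolyC1.
have thE : cstp 3 th' = Params (u%:MP * pa (cstp 3 th)) (u%:MP * pb (cstp 3 th))
    (u%:MP * pc (cstp 3 th)) (u%:MP * pd (cstp 3 th)) (u%:MP * pe (cstp 3 th))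
    (u%:MP * pt (cstp 3 th)) (pk (cstp 3 th)) (pl (cstp 3 th))
    ((u^-1)%:MP * pm (cstp 3 th)) ((u^-1)%:MP * pn (cstp 3 th))
    ((u^-1)%:MP * pp (cstp 3 th)) ((u^-1)%:MP * pq (cstp 3 th)).
  by rewrite /cstp /map_params /= !mpolyCM.
have [eA eB] := cr_rescale (cstp 3 th) (affine_lin s1 s2 s3)
  (affine_lin r1 r2 r3) 'X_2 uv.
by rewrite /cr_form thE eA eB.
Qed.

(** The coordinates are isotropic and the centre is [(0, 1)].  The equations
    force [m = 0], so that the line [X = 0] through the centre and the origin is
    one of the two lines, and [n = 2 p], [p (c - 1) = 1] for the parameters [p],
    [c].  After rescaling to [p = 1] the last equation becomes linear.  The
    conic of the example at [s = 1] is
    [2 X ^ 2 + 2 (Y + 1) ^ 2 + 2 (Y + 1) = 0]. *)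
Lemma closure_center_isotropic s1 s2 r1 r2 th :
  let det := s1 * r2 - s2 * r1 in
  det != 0 -> r1 ^+ 2 + r2 ^+ 2 = 0 -> s1 ^+ 2 + s2 ^+ 2 = 0 ->
  s1 * r1 + s2 * r2 = 1 ->
  pt th = 1 -> poincare (cr_form s1 s2 0 r1 r2 (-1) th) ->
  zariski_closure (@X_211 C) (cr_form s1 s2 0 r1 r2 (-1) th).
Proof.
move=> det det0 rr ss sr; case: th => a b c d e t k l m n p q /= -> {t}.
have det2 : det ^+ 2 = -1.
  transitivity ((s1 ^+ 2 + s2 ^+ 2) * (r1 ^+ 2 + r2 ^+ 2)
    - (s1 * r1 + s2 * r2) ^+ 2); first by rewrite /det; ring.
  by rewrite rr ss sr; ring.
move/(poincare_cr_form 0 (-1) det0); rewrite -/det det2 rr ss sr => -[].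
unfold_cr => -[eA eB] eAX eAY eBX eBY.
have m0 : m = 0.
  have mc1 : m * (1 - c) = 0 by rewrite -[RHS]eB; ring.
  have mc2 : 2 * (m * c) = m * (1 - c).
    by rewrite -[RHS]subr0 -[in RHS]eBY; ring.
  have /eqP : 2 * m = 0.
    transitivity (2 * (m * (1 - c)) + 2 * (m * c)); first by ring.
    by rewrite mc2 mc1; ring.
  by rewrite mulf_eq0 pnatr_eq0 => /eqP.
rewrite {}m0 in eA eB eAX eAY eBX eBY *.
have k_eq : k = p * (c - e + 1) by apply/eqP; rewrite -subr_eq0 -[0]eA; apply/eqP; ring.
have l_eq : l = q * (c - e + 1) - n * (d - b).
  by apply/eqP; rewrite -subr_eq0 -[0]eAX; apply/eqP; ring.
have pc : p * (c - 1) = 1.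
  by apply: oppr_inj; rewrite -[RHS]eAY k_eq; ring.
have nc : n * (c - 1) = 2.
  set E := (X in X = _) in eBX; transitivity (- E + p * (c - 1)).
    by rewrite /E k_eq; ring.
  by rewrite eBX pc opprK.
have n_eq : n = 2 * p.
  by rewrite -nc mulrAC -mulrA pc mulr1.
have p0 : p != 0.
  by apply: contra_eq_neq pc => ->; rewrite mul0r eq_sym oner_neq0.
rewrite (cr_form_rescale _ _ _ _ _ _ _ p0) /=.
pose fam s :=
  let a' := interp (p * a) (-1) s in let b' := interp (p * b) 0 s in
  let t' := interp p (-2) s in let c' := t' + 1 in
  let d' := interp (p * d) 0 s in let e' := interp (p * e) 0 s in
  let q' := interp (p^-1 * q) 0 s in
  let k' := c' - e' + t' in
  Params a' b' c' d' e' t' k' (q' * k' - 2 * (d' - b')) 0 2 1 q' : params C.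
have -> : Params (p * a) (p * b) (p * c) (p * d) (p * e) (p * 1) k l (p^-1 * 0)
    (p^-1 * n) (p^-1 * p) (p^-1 * q) = fam 0.
  have c_eq : p * c = p + 1 by rewrite -pc; ring.
  rewrite /fam !interp0 c_eq mulr1 mulr0 mulVf // n_eq l_eq n_eq k_eq.
  congr Params.
  - by rewrite -c_eq; ring.
  - by rewrite -c_eq; field.
  - by field.
apply: (@closure_cr_family C s1 s2 0 r1 r2 (-1) det0 fam (fun=> Line 1 0 0)
  (fun s => Line (- interp (p^-1 * q) 0 s) 1 0)).
- by split; split; rewrite /=; solve_polyfun.
- by split; rewrite /=; solve_polyfun.
- by split; rewrite /=; solve_polyfun.
- by [].
- by move=> s; split=> /=; ring.
- move=> s; apply/(poincare_cr_form 0 (-1) det0); rewrite -/det det2 rr ss sr /fam.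
  by unfold_cr; split; first split; ring.
- by rewrite /crD /= (_ : _ - _ = - 2) ?oppr_eq0 ?pnatr_eq0 //; ring.
- have -> : crF_conic (fam 1) = Conic 2 0 2 0 6 4.
    by rewrite /fam !interp1 /crF_conic /crD /=; congr Conic; ring.
  rewrite interp1; unfold_gp.
  (* the factors of [general_position], in order *)
  set g := (X in X != 0).
  rewrite (_ : g = 8 * 16 * (4 * 32) * (2 * 2) * 4); last by rewrite /g; ring.
  by rewrite !mulf_neq0 ?pnatr_eq0.
Qed.

(** The coordinates are orthogonal and the centre is [(1, 0)]; [2 h] is the value
    of [x ^ 2 + y ^ 2] there.  The equations force [q = - h], [a = 1], [b = 0]
    and give [k], [l] in terms of the other parameters.  The parameters [m] and
    [n] are replaced by the two roots [m1], [m2] of [M], which makes the lines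
    [X = m1 Y] and [X = m2 Y] polynomial in [s].  The example at [s = 1] has
    lines [X = Y] and [X = - Y], and the conic [X ^ 2 + 2 Y ^ 2 + 4 X + 1 = 0]. *)
Lemma closure_center_anisotropic s1 s2 r1 r2 (h : C) th :
  let det := s1 * r2 - s2 * r1 in
  det != 0 -> h != 0 ->
  r1 ^+ 2 + r2 ^+ 2 = det ^+ 2 * (2 * h) -> s1 ^+ 2 + s2 ^+ 2 = det ^+ 2 * (2 * h) ->
  s1 * r1 + s2 * r2 = 0 ->
  pt th = 1 -> poincare (cr_form s1 s2 (-1) r1 r2 0 th) ->
  zariski_closure (@X_211 C) (cr_form s1 s2 (-1) r1 r2 0 th).
Proof.
move=> det det0 h0 rr ss sr; case: th => a b c d e t k l m n p q /= -> {t}.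
move/(poincare_cr_form (-1) 0 det0); rewrite -/det rr ss sr oppr0 => -[].
have det20 : det ^+ 2 != 0 by rewrite expf_neq0.
unfold_cr => -[eA eB] /(mulfI det20) eAX eAY eBX /(mulfI det20) eBY.
move/eqP: eAY; rewrite mulf_eq0 (negPf det20) /= => /eqP eAY.
move/eqP: eBX; rewrite mulf_eq0 (negPf det20) /= => /eqP eBX.
have qa0 : q * (1 - a) = 0 by apply: oppr_inj; rewrite oppr0 -[RHS]eA; ring.
have qa : - (a * q) = h.
  apply: (mulfI (_ : 2 != 0)); first by rewrite pnatr_eq0.
  by rewrite -eAX -[LHS]add0r -[X in X + _]qa0; ring.
have q_eq : q = - h by rewrite -qa opprK -[LHS]subr0 -qa0; ring.
have a1 : a = 1.
  move/eqP: qa0; rewrite mulf_eq0 q_eq oppr_eq0 (negPf h0) subr_eq0 /=.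
  by move/eqP.
rewrite {qa0 qa}a1 {}q_eq in eA eB eAX eAY eBX eBY *.
have b0 : b = 0.
  apply: (mulfI h0); rewrite mulr0.
  set E := (X in X = _) in eBX; set E' := (X in X = _) in eB.
  transitivity (E + 2 * E'); first by rewrite /E /E'; ring.
  by rewrite eBX eB; ring.
rewrite {}b0 in eA eB eAX eAY eBX eBY *.
have l_eq : l = n * (2 - d) + h * e.
  set E := (X in X = _) in eB.
  by transitivity (l + E); [rewrite eB addr0 | rewrite /E; ring].
have k_eq : k = 2 * h * (1 - c) + m * (2 - d) - p * e.
  set E := (X in X = _) in eBY.
  transitivity (k + 2 * h - E); first by rewrite eBY; ring.
  by rewrite /E; ring.
pose sum := (p - n) / h; pose prod := m / h.
pose rt := sqrtC (sum ^+ 2 - 4 * prod).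
pose m1 := (sum + rt) / 2; pose m2 := (sum - rt) / 2.
have n_eq : n = p - h * (m1 + m2).
  by rewrite /m1 /m2 /sum; field; rewrite ?h0 ?pnatr_eq0.
have m_eq : m = h * (m1 * m2).
  have -> : m1 * m2 = (sum ^+ 2 - rt ^+ 2) / 4.
    by rewrite /m1 /m2; field; rewrite ?pnatr_eq0.
  by rewrite /rt sqrtCK /prod; field; rewrite ?h0 ?pnatr_eq0.
clearbody m1 m2.
pose fam s :=
  let c' := interp c 2 s in let d' := interp d 4 s in
  let e' := interp e 0 s in let p' := interp p 0 s in
  let m1' := interp m1 1 s in let m2' := interp m2 (-1) s in
  let m' := h * (m1' * m2') in let n' := p' - h * (m1' + m2') in
  Params 1 0 c' d' e' 1 (2 * h * (1 - c') + m' * (2 - d') - p' * e')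
   (n' * (2 - d') + h * e') m' n' p' (- h) : params C.
have -> : Params 1 0 c d e 1 k l m n p (- h) = fam 0.
  by rewrite /fam !interp0 k_eq l_eq -m_eq -n_eq.
apply: (@closure_cr_family C s1 s2 (-1) r1 r2 0 det0 fam
  (fun s => Line h (- h * interp m1 1 s) 0)
  (fun s => Line 1 (- interp m2 (-1) s) 0)).
- by split; split; rewrite /=; solve_polyfun.
- by split; rewrite /=; solve_polyfun.
- by split; rewrite /=; solve_polyfun.
- by [].
- by move=> s; split=> /=; ring.
- move=> s; apply/(poincare_cr_form (-1) 0 det0); rewrite -/det rr ss sr oppr0 /fam.
  by unfold_cr; split; first split; ring.
- rewrite /fam !interp1 /crD /= (_ : _ - _ = h ^+ 2) ?expf_neq0 //; ring.
- have -> : crF_conic (fam 1) =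
      Conic (h ^+ 2) 0 (2 * h ^+ 2) (4 * h ^+ 2) 0 (h ^+ 2).
    by rewrite /fam !interp1 /crF_conic /crD /=; congr Conic; ring.
  rewrite !interp1; unfold_gp.
  (* the factors of [general_position], in order *)
  set g := (X in X != 0).
  rewrite (_ : g = - (24 * 8 * 2 * (4 * 4) * (3 * 3) * 4) * h ^+ 31); last first.
    by rewrite /g; ring.
  by rewrite mulf_neq0 ?expf_neq0 ?oppr_eq0 ?mulf_neq0 ?pnatr_eq0.
Qed.

Lemma X_CR16_closure (w : V3 C) : X_CR16 w -> zariski_closure (@X_211 C) w.
Proof.
move=> [/Y_CR16_cr_form[c1 [c2 normal]] w0].
have [N NE] : exists N, N = c1 ^+ 2 + c2 ^+ 2 by exists (c1 ^+ 2 + c2 ^+ 2).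
have [N0|N0] := eqVneq N 0; last first.
  (* coordinates along [c] and along its orthogonal, with [c] at [(1, 0)] *)
  have det_eq : c1 / N * (c1 / N) - c2 / N * (- c2 / N) = N^-1.
    by transitivity ((c1 ^+ 2 + c2 ^+ 2) / N / N); [field | rewrite -NE; field].
  have det0 : c1 / N * (c1 / N) - c2 / N * (- c2 / N) != 0.
    by rewrite det_eq invr_eq0.
  have [th [t1 wE]] := normal _ _ _ _ det0.
  have s3 : - (c1 / N * c1 + c2 / N * c2) = -1.
    by congr (- _); transitivity ((c1 ^+ 2 + c2 ^+ 2) / N);
      [field | rewrite -NE mulfV].
  have r3 : - (- c2 / N * c1 + c1 / N * c2) = 0 by field.
  move: w0; rewrite {}wE s3 r3.
  apply: (@closure_center_anisotropic _ _ _ _ (N / 2) _ det0); rewrite ?det_eq //.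
  - by rewrite mulf_neq0 ?invr_eq0 ?pnatr_eq0.
  - transitivity ((c1 ^+ 2 + c2 ^+ 2) / N ^+ 2); first by field.
    by rewrite -NE; field.
  - transitivity ((c1 ^+ 2 + c2 ^+ 2) / N ^+ 2); first by field.
    by rewrite -NE; field.
  - by field.
have two0 : (2 : C) != 0 by rewrite pnatr_eq0.
have [c10|c10] := eqVneq c1 0.
  have c20 : c2 = 0.
    by apply/eqP; rewrite -sqrf_eq0 -N0 NE c10; apply/eqP; ring.
  (* isotropic coordinates [x + 'i y] and [(x - 'i y) / 2] *)
  have i2 := sqrCi C.
  have det_eq : 1 * (- 'i / 2) - 'i * (1 / 2) = - 'i :> C by field.
  have det0 : 1 * (- 'i / 2) - 'i * (1 / 2) != 0 :> C.
    by rewrite det_eq oppr_eq0 neq0Ci.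
  have [th [t1 wE]] := normal _ _ _ _ det0.
  move: w0; rewrite {}wE c10 c20 !mulr0 addr0 oppr0.
  apply: closure_center_origin => //.
  - by transitivity ((1 + 'i ^+ 2) / 4 : C); [field | rewrite i2 subrr mul0r].
  - by rewrite i2; ring.
  - by transitivity ((1 - 'i ^+ 2) / 2 : C); [field | rewrite i2 opprK divff].
(* isotropic coordinates again, with [c] at [(0, 1)]: the first one vanishes on
   the isotropic line through [c] *)
have c2sq : c2 ^+ 2 = - c1 ^+ 2.
  by apply/eqP; rewrite -subr_eq0 opprK addrC -NE N0.
have c20 : c2 != 0 by rewrite -sqrf_eq0 c2sq oppr_eq0 sqrf_eq0.
have det_eq : c1 * (2 * c2)^-1 - c2 * (2 * c1)^-1 = c1 / c2.
  transitivity ((c1 ^+ 2 - c2 ^+ 2) / (2 * c1 * c2)); first by field; rewrite ?c10 ?c20.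
  by rewrite c2sq; field; rewrite ?c10 ?c20.
have det0 : c1 * (2 * c2)^-1 - c2 * (2 * c1)^-1 != 0.
  by rewrite det_eq mulf_neq0 ?invr_eq0.
have [th [t1 wE]] := normal _ _ _ _ det0.
have s3 : - (c1 * c1 + c2 * c2) = 0 by rewrite -!expr2 -NE N0 oppr0.
have r3 : - ((2 * c1)^-1 * c1 + (2 * c2)^-1 * c2) = -1.
  by field; rewrite ?c10 ?c20.
move: w0; rewrite {}wE s3 r3.
apply: closure_center_isotropic => //.
- transitivity ((c1 ^+ 2 + c2 ^+ 2) / (4 * c1 ^+ 2 * c2 ^+ 2)).
    by field; rewrite ?c10 ?c20.
  by rewrite -NE N0 mul0r.
- by rewrite -NE.
- by field; rewrite ?c10 ?c20.
Qed.

End Cases.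

Theorem proposition6p5 (R : realType) :
  (exists U : 'rV[R[i]]_11 -> Prop,
     [/\ zariski_open U,
         (exists v, U v)
       & forall a b c d e k l m n p q : R[i],
           U (\row_(i < 11) [:: a; b; c; d; e; k; l; m; n; p; q]`_i) ->
           let w := affine_form (cr16P a b c d e k l m n p q)
                                (cr16Q a b c d e k l m n p q) in
           integral_curve w 2
             (homogenize 2 (cr16_conic a b c d e k l m n p q)) /\
           darboux_integrable w])
  /\
  (forall w : V3 R[i], X_CR16 w -> zariski_closure (@X_211 R[i]) w).
Proof.
split.
  have [U [U_open U_ne hU]] := cr16_generic_open R[i].
  exists U; split=> // a b c d e k l m n p q /hU[m0 D0] w.
  have [eP eQ eF] := homogenize_cr16 a b c d e k l m n p q.
  rewrite eF; split.
    exact: (@cr16_integral_conic _ (Params a b c d e 1 k l m n p q) w eP eQ D0 (oner_neq0 _)).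
  exact: (@cr16_darboux _ (Params a b c d e 1 k l m n p q) w eP eQ D0 m0 (oner_neq0 _)).
exact: X_CR16_closure.
Qed.
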